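(* If $(W,S)$ is a finite irreducible Coxeter system with Coxeter number $h$, then \[\operatorname{E}(W)\,=\,\frac{h}{2}\,\sum_{s\in S}\operatorname{NC}(W_{\langle s\rangle}).\]
   Context: Let $(W,S)$ be a finite Coxeter system of rank $n=|S|$ and let $T$ be the set of reflections of $W$ (all conjugates of elements of $S$). The absolute length $\ell_T(w)$ of $w\in W$ is the minimal length of a word in the alphabet $T$ representing $w$; a word in $T$ for $w$ of this minimal length is a reduced $T$-word for $w$. The absolute order on $W$ sets $u\le v$ if and only if $u$ has a reduced $T$-word which is a prefix of some reduced $T$-word for $v$. A Coxeter element is $c=s_1s_2\cdots s_n$ with each element of $S$ occurring exactly once. The noncrossing partition lattice $L_W$ is the interval $[1,c]$ in the absolute order; its isomorphism type does not depend on the choice of $c$, and it is graded of rank $n$ with rank function $\ell_T$. The Coxeter number $h$ of an irreducible $W$ is the order of a Coxeter element. $\operatorname{E}(W)$ is the number of edges in the Hasse diagram of $L_W$ (i.e. the number of cover relations in $L_W$), and $\operatorname{NC}(W)$ is the number of elements of $L_W$. For $s\in S$, $W_{\langle s\rangle}$ denotes the parabolic subgroup of $W$ generated by $S\setminus\{s\}$, regarded as a Coxeter system with simple reflections $S\setminus\{s\}$ (possibly reducible or trivial). *)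

(* Defs.v *)
From HB Require Import structures.
From mathcomp Require Import all_boot all_order all_algebra all_fingroup.
From mathcomp Require Import boolp.

Set Implicit Arguments.
Unset Strict Implicit.
Unset Printing Implicit Defensive.

Local Open Scope group_scope.

(* W is presented by the generators S and the relations (s t)^m(s,t) = 1,
   where m(s,t) is the order of s t in W: this is the universal property of
   the presentation, tested against all groups, finite or not. *)
Definition coxeter_presentation (gT : finGroupType) (W S : {set gT}) : Prop :=
  forall (H : groupType) (f : gT -> H),
    {in S &, forall s t, (f s * f t) ^+ #[s * t] = 1} ->
    exists2 phi : gT -> H,
      {in W &, {morph phi : x y / x * y}} & {in S, phi =1 f}.

Definition coxeter_system (gT : finGroupType) (W : {group gT}) (S : {set gT})
    : Prop :=
  [/\ <<S>> = W, {in S, forall s, #[s] = 2} & coxeter_presentation W S].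

Definition coxeter_graph (gT : finGroupType) (S : {set gT}) : rel gT :=
  [rel s t | [&& s \in S, t \in S & 3 <= #[s * t]]].

Definition coxeter_irreducible (gT : finGroupType) (S : {set gT}) : Prop :=
  S != set0 /\ {in S &, forall s t, connect (coxeter_graph S) s t}.

Definition coxeter_element (gT : finGroupType) (S : {set gT}) (c : gT) : Prop :=
  exists2 r : seq gT, perm_eq r (enum S) & c = \prod_(s <- r) s.

Definition coxeter_number (gT : finGroupType) (S : {set gT}) (h : nat) : Prop :=
  exists2 c : gT, coxeter_element S c & h = #[c].

Definition reflections (gT : finGroupType) (W S : {set gT}) : {set gT} :=
  [set s ^ w | s in S, w in W].

Section AbsoluteOrder.

Variables (gT : finGroupType) (T : {set gT}).
Implicit Types (u v w : gT) (r : seq gT).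

Definition is_word r w : Prop := {subset r <= T} /\ \prod_(t <- r) t = w.

Definition reduced_word r w : Prop :=
  is_word r w /\ forall r', is_word r' w -> size r <= size r'.

Definition absolute_le u v : Prop :=
  exists r r', [/\ reduced_word r u, reduced_word r' v & prefix r r'].

Definition absolute_lt u v : Prop := absolute_le u v /\ u <> v.

Definition absolute_interval u v : {set gT} :=
  [set x | `[< absolute_le u x /\ absolute_le x v >]].

End AbsoluteOrder.

(* The poset L_W, taken with respect to the Coxeter element c; its order is
   absolute_le (reflections W S). *)
Definition noncrossing (gT : finGroupType) (W S : {set gT}) (c : gT)
    : {set gT} :=
  absolute_interval (reflections W S) 1 c.

Definition noncrossing_cover (gT : finGroupType) (W S : {set gT}) (c u v : gT)
    : Prop :=
  let lt := absolute_lt (reflections W S) in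
  [/\ u \in noncrossing W S c, v \in noncrossing W S c, lt u v
    & ~ exists2 x, x \in noncrossing W S c & lt u x /\ lt x v].

Definition NC (gT : finGroupType) (W S : {set gT}) (c : gT) : nat :=
  #|noncrossing W S c|.

Definition E (gT : finGroupType) (W S : {set gT}) (c : gT) : nat :=
  #|[set p : gT * gT | `[< noncrossing_cover W S c p.1 p.2 >]]|.

Definition parabolic (gT : finGroupType) (S : {set gT}) (s : gT) : {group gT} :=
  <<S :\ s>>%G.

(* Main.v *)
Require Import Defs.
From HB Require Import structures.
From mathcomp Require Import all_boot all_order all_algebra all_fingroup.
From mathcomp Require Import Rstruct boolp reals trigo.
From mathcomp Require Import ring lra zify.

(* In the reflection representation, let w_1, ..., w_n be the fundamental weights
   and c = s_1 ... s_n a Coxeter element.  The roots b_i = w_i - w_i c are the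
   images of the simple roots under the final segments s_{i+1} ... s_n of c, and
   the reflection t_i in b_i satisfies c t_i = s_1 ... (omit s_i) ... s_n.  The
   h n roots b_i c^k are distinct: 1 - c is injective, so b_i c^k = b_j forces
   w_i c^k = w_j, hence i = j because distinct weights of the closed fundamental
   chamber are not conjugate; and w_i + w_i c is, up to a group element, a
   positive combination of the neighbouring weights, so that a power of c fixing
   w_i fixes the neighbours of w_i, hence everything by irreducibility.  They
   exhaust the roots: the sum of a root over its c-orbit is fixed by c, hence 0,
   so the orbit contains a negative root whose image by c is positive, and that
   image is some b_i.  Each reflection is thus t_i conjugated by c^k for exactly
   two pairs (i, k).

   A cover u < t u of the interval [1, c] is the same as a reflection t with an
   element u of [1, t c], so E(W) is the sum over all reflections of the
   cardinal of [1, t c], which is h/2 times the sum over i of that of [1, c t_i].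
   Reflections in a shortest factorisation of c t_i fix w_i, hence lie in the
   parabolic subgroup omitting s_i, so [1, c t_i] is its noncrossing partition
   lattice.  The choice of Coxeter elements is irrelevant because the Coxeter
   graph is a forest. *)

Set Implicit Arguments.
Unset Strict Implicit.
Unset Printing Implicit Defensive.

Import Order.TTheory GRing.Theory Num.Theory.
Local Open Scope ring_scope.

(** * The general linear group, a possibly infinite target for the presentation *)

Definition invertible_matrix (K : fieldType) (n : nat) :=
  {M : 'M[K]_n | M \in unitmx}.

Section InvertibleMatrixGroup.
Variables (K : fieldType) (n : nat).
Implicit Types M N : invertible_matrix K n.

Lemma mulmx_unitmx M N : (val M *m val N)%R \in unitmx.
Proof. by rewrite unitmx_mul (valP M) (valP N). Qed.

Lemma invmx_unitmx M : invmx (val M) \in unitmx.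
Proof. by rewrite unitmx_inv (valP M). Qed.

Definition invertible_one : invertible_matrix K n :=
  @exist 'M[K]_n (fun A => A \in unitmx) _ (unitmx1 K n).
Definition invertible_mul M N : invertible_matrix K n :=
  @exist 'M[K]_n (fun A => A \in unitmx) _ (mulmx_unitmx M N).
Definition invertible_inv M : invertible_matrix K n :=
  @exist 'M[K]_n (fun A => A \in unitmx) _ (invmx_unitmx M).

Lemma invertible_mulA : associative invertible_mul.
Proof. by move=> L M N; apply: val_inj => /=; rewrite mulmxA. Qed.

Lemma invertible_mul1 : left_id invertible_one invertible_mul.
Proof. by move=> M; apply: val_inj => /=; rewrite mul1mx. Qed.

Lemma invertible_mulr1 : right_id invertible_one invertible_mul.
Proof. by move=> M; apply: val_inj => /=; rewrite mulmx1. Qed.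

Lemma invertible_mulV : left_inverse invertible_one invertible_inv invertible_mul.
Proof. by move=> M; apply: val_inj => /=; rewrite mulVmx ?(valP M). Qed.

Lemma invertible_mulrV : right_inverse invertible_one invertible_inv invertible_mul.
Proof. by move=> M; apply: val_inj => /=; rewrite mulmxV ?(valP M). Qed.

End InvertibleMatrixGroup.

HB.instance Definition _ (K : fieldType) (n : nat) :=
  Choice.on (invertible_matrix K n).
HB.instance Definition _ (K : fieldType) (n : nat) :=
  isGroup.Build (invertible_matrix K n) (@invertible_mulA K n)
    (@invertible_mul1 K n) (@invertible_mulr1 K n)
    (@invertible_mulV K n) (@invertible_mulrV K n).

(** * Chebyshev recurrence and dihedral angles *)

Fixpoint chebU (K : nzRingType) (a : K) (j : nat) : K :=
  if j is j1.+1 then if j1 is j2.+1 then a * chebU a j1 - chebU a j2 else 1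
  else 0.

Lemma chebUSS (K : nzRingType) (a : K) j :
  chebU a j.+2 = a * chebU a j.+1 - chebU a j.
Proof. by []. Qed.

(** With th = pi / m and a = 2 cos th, [chebU a j] is the Chebyshev value U_{j-1}(a / 2) = sin (j
    th) / sin th. These four properties replace trigonometry from here on. *)
Lemma dihedral_parameter (R : realType) (m : nat) : (1 < m)%N ->
  exists a : R, [/\ a < 2, chebU a m = 0, chebU a m.+1 = -1
    & forall j, (j <= m)%N -> 0 <= chebU a j].
Proof.
move=> m_gt1; pose th : R := pi / m%:R.
have m_gt0 : 0 < m%:R :> R by rewrite ltr0n; lia.
have thm : th * m%:R = pi by rewrite /th divfK // gt_eqF.
have th_gt0 : 0 < th by rewrite divr_gt0 ?pi_gt0.
have th_ltpi : th < pi.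
  by rewrite /th ltr_pdivrMr // ltr_pMr ?pi_gt0 // ltr1n.
have s_gt0 : 0 < sin th by rewrite sin_gt0_pi // th_gt0.
have UE j : sin th * chebU (2 * cos th) j = sin (th * j%:R)
    /\ sin th * chebU (2 * cos th) j.+1 = sin (th * j.+1%:R).
  elim: j => [|j [IH1 IH2]]; first by rewrite /= !mulr0 !mulr1 sin0.
  split=> //; rewrite chebUSS mulrBr mulrCA IH1 IH2.
  rewrite -(natr1 j.+1) mulrDr mulr1 (sinD (th * j.+1%:R)).
  have -> : th * j%:R = th * j.+1%:R - th by rewrite -natr1 mulrDr mulr1 addrK.
  by rewrite sinB; ring.
exists (2 * cos th); split.
- rewrite gtr_pMr // -cos0 ltr_cos // in_itv /= ?lexx ?pi_ge0 //.
  by rewrite !ltW.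
- apply: (mulfI (lt0r_neq0 s_gt0)); rewrite (proj1 (UE m)) thm sinpi mulr0 //.
- apply: (mulfI (lt0r_neq0 s_gt0)); rewrite (proj2 (UE m)).
  by rewrite -natr1 mulrDr thm mulr1 addrC sinDpi mulrN1.
- move=> j le_jm; rewrite -(pmulr_rge0 _ s_gt0) (proj1 (UE j)).
  rewrite sin_ge0_pi // -thm ler_pM2l // ler_nat le_jm andbT.
  by rewrite mulr_ge0 ?ler0n // ltW.
Qed.

(** * Word length and absolute order *)

Section WordLength.
Local Open Scope group_scope.
Variables (gT : finGroupType) (A : {set gT}).
Implicit Types (u v w x : gT) (r : seq gT).

Lemma is_word_nil : is_word A [::] 1.
Proof. by split; rewrite ?big_nil. Qed.

Lemma is_word_cat r1 r2 u v :
  is_word A r1 u -> is_word A r2 v -> is_word A (r1 ++ r2) (u * v).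
Proof.
move=> [r1A <-] [r2A <-]; split; last by rewrite big_cat.
by move=> x; rewrite mem_cat => /orP[/r1A|/r2A].
Qed.

Lemma is_word1 x : x \in A -> is_word A [:: x] x.
Proof. by move=> Ax; split=> [y|]; rewrite ?big_seq1 // inE => /eqP->. Qed.

Lemma is_word_gen r w : is_word A r w -> w \in <<A>>.
Proof.
by case=> rA <-; rewrite big_seq group_prod // => x /rA Ax; apply: mem_gen.
Qed.

Lemma gen_is_word w : w \in <<A>> -> exists r, is_word A r w.
Proof.
case/gen_prodgP=> n [f fA ->]; exists [seq f i | i <- index_enum 'I_n]; split.
  by move=> x /mapP[i _ ->].
by rewrite big_map.
Qed.

(* Junk value 0 when [w] is not in the subgroup generated by [A]. *)
Definition word_length w : nat :=
  if pselect (exists k, `[< exists2 r, is_word A r w & size r = k >]) is left ex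
  then ex_minn ex else 0.

Lemma word_lengthP w :
  w \in <<A>> -> exists2 r, is_word A r w & size r = word_length w.
Proof.
case/gen_is_word=> r0 r0w; rewrite /word_length; case: pselect => [ex|[]].
  by case: ex_minnP => k /asboolP[r rw <-] _; exists r.
by exists (size r0); apply/asboolP; exists r0.
Qed.

Lemma word_length_min r w : is_word A r w -> (word_length w <= size r)%N.
Proof.
move=> rw; rewrite /word_length; case: pselect => // ex.
by case: ex_minnP => k _; apply; apply/asboolP; exists r.
Qed.

Lemma reduced_wordE r w :
  reduced_word A r w <-> is_word A r w /\ size r = word_length w.
Proof.
split=> [] [rw rmin]; split=> //; last by move=> r' /word_length_min; rewrite rmin.
apply/eqP; rewrite eqn_leq (word_length_min rw) andbT.
by have [r' r'w <-] := word_lengthP (is_word_gen rw); apply: rmin.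
Qed.

Lemma word_length1 : word_length 1 = 0%N.
Proof. by apply/eqP; rewrite -leqn0 (word_length_min is_word_nil). Qed.

Lemma word_length_eq0 w : w \in <<A>> -> word_length w = 0%N -> w = 1.
Proof.
by case/word_lengthP=> r [_ <-] <- /size0nil->; rewrite big_nil.
Qed.

Lemma word_length_mem x : x \in A -> (word_length x <= 1)%N.
Proof. by move=> Ax; apply: (word_length_min (is_word1 Ax)). Qed.

Lemma word_length_eq1 w : w \in <<A>> -> word_length w = 1%N -> w \in A.
Proof.
case/word_lengthP=> r [rA <-] <-; case: r rA => [|x [|]] // rA _.
by rewrite big_seq1 rA ?mem_head.
Qed.

Lemma word_lengthM u v : u \in <<A>> -> v \in <<A>> ->
  (word_length (u * v) <= word_length u + word_length v)%N.
Proof.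
move=> /word_lengthP[r1 r1u <-] /word_lengthP[r2 r2v <-].
by rewrite -size_cat word_length_min //; apply: is_word_cat.
Qed.

Lemma word_length_split w k : w \in <<A>> -> (k <= word_length w)%N ->
  exists u v, [/\ u \in <<A>>, v \in <<A>>, w = u * v,
    word_length u = k & word_length v = (word_length w - k)%N].
Proof.
move=> Aw; have [r [rA <-] szr] := word_lengthP Aw; rewrite -szr => lekr.
have w1 : is_word A (take k r) (\prod_(x <- take k r) x).
  by split=> // x /mem_take/rA.
have w2 : is_word A (drop k r) (\prod_(x <- drop k r) x).
  by split=> // x /mem_drop/rA.
have e : \prod_(x <- r) x
    = (\prod_(x <- take k r) x) * (\prod_(x <- drop k r) x).
  by rewrite -big_cat cat_take_drop.
exists (\prod_(x <- take k r) x), (\prod_(x <- drop k r) x).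
have A1 := is_word_gen w1; have A2 := is_word_gen w2; split=> //.
  have := word_lengthM A1 A2; have := word_length_min w1.
  have := word_length_min w2; rewrite -e size_drop size_take_min -szr; lia.
have := word_lengthM A1 A2; have := word_length_min w1.
have := word_length_min w2; rewrite -e size_drop size_take_min -szr; lia.
Qed.

(** Deleting the prefix for u from a reduced word for v leaves a word for u^-1 v; conversely,
    reduced words for u and u^-1 v concatenate to a word for v, reduced when the lengths add up. *)
Lemma absolute_leE u v :
  absolute_le A u v <-> [/\ u \in <<A>>, v \in <<A>>
    & (word_length u + word_length (u^-1 * v))%N = word_length v].
Proof.
split=> [[r [r' [/reduced_wordE[ru szr] /reduced_wordE[r'v szr']]]] | [Au Av e]].
  case/prefixP=> r2 r'E; have Au := is_word_gen ru; have Av := is_word_gen r'v.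
  have r2w : is_word A r2 (u^-1 * v).
    split=> [x r2x|]; first by apply: r'v.1; rewrite r'E mem_cat r2x orbT.
    by case: r'v => _ <-; rewrite r'E big_cat /= ru.2 mulKg.
  split=> //; apply/eqP; rewrite eqn_leq; apply/andP; split.
    by rewrite -szr' -szr r'E size_cat leq_add2l word_length_min.
  by rewrite -{1}(mulKVg u v) word_lengthM ?groupM ?groupV.
have [r1 r1u sz1] := word_lengthP Au.
have [|r2 r2u sz2] := @word_lengthP (u^-1 * v); first by rewrite groupM ?groupV.
exists r1, (r1 ++ r2); split; last exact: prefix_prefix.
  by apply/reduced_wordE.
apply/reduced_wordE; split; last by rewrite size_cat sz1 sz2.
by rewrite -(mulKVg u v); apply: is_word_cat.
Qed.

Lemma absolute_interval1E v x : v \in <<A>> ->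
  x \in absolute_interval A 1 v = (x \in <<A>>) &&
    (word_length x + word_length (x^-1 * v) == word_length v)%N.
Proof.
move=> Av; rewrite inE; apply/asboolP/andP => [[_ /absolute_leE[Ax _ /eqP]]|[Ax e]].
  by [].
split; apply/absolute_leE; rewrite ?group1 ?Ax ?Av ?invg1 ?mul1g ?word_length1 //.
by split=> //; apply/eqP.
Qed.

End WordLength.

(** * Invariance under conjugation by the normalizer of the alphabet *)

Section WordLengthConj.
Local Open Scope group_scope.
Variables (gT : finGroupType) (A : {set gT}).

Lemma word_lengthJ_le x w : A :^ x \subset A -> w \in <<A>> ->
  (word_length A (w ^ x) <= word_length A w)%N.
Proof.
move=> /subsetP Ax /word_lengthP[r [rA <-] <-].
rewrite -(size_map (conjg^~ x) r) word_length_min //; split.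
  by move=> _ /mapP[y /rA Ay ->]; apply: Ax; rewrite memJ_conjg.
rewrite big_map; elim: r {rA} => [|y r IHr]; first by rewrite !big_nil conj1g.
by rewrite !big_cons conjMg IHr.
Qed.

Lemma word_lengthJ x w : x \in 'N(A) -> w \in <<A>> ->
  word_length A (w ^ x) = word_length A w.
Proof.
move=> Nx Aw; apply/eqP; rewrite eqn_leq word_lengthJ_le ?(normP Nx) //=.
rewrite -{1}(conjgK x w) word_lengthJ_le //.
  by rewrite (normP _) // groupV.
by rewrite memJ_norm // (subsetP (norm_gen _)).
Qed.

Lemma card_absolute_intervalJ x v : x \in 'N(A) -> v \in <<A>> ->
  #|absolute_interval A 1 (v ^ x)| = #|absolute_interval A 1 v|.
Proof.
move=> Nx Av; have Ngx := subsetP (norm_gen A) x Nx.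
rewrite -(cardJg (absolute_interval A 1 v) x); apply: eq_card => y.
have Avx : v ^ x \in <<A>> by rewrite memJ_norm.
have [z ->] : exists z, y = z ^ x by exists (y ^ x^-1); rewrite conjgKV.
rewrite memJ_conjg !absolute_interval1E // -conjVg.
rewrite -conjMg memJ_norm //; case Ay: (_ \in _) => //=.
by rewrite !word_lengthJ // groupM ?groupV.
Qed.

End WordLengthConj.

(** If the T-lengths of x and x^-1 w add up to that of w, their words concatenate to a reduced word,
    so all letters lie in T' and the T'-lengths add up too. Conversely, T-length never exceeds
    T'-length and the two agree at w. *)
Lemma absolute_interval_sub (gT : finGroupType) (T T' : {set gT}) (w : gT) :
  T' \subset T -> w \in <<T'>>%g ->
  (forall r, is_word T r w -> size r = word_length T w -> {subset r <= T'}) ->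
  absolute_interval T 1%g w = absolute_interval T' 1%g w.
Proof.
move=> sT'T w_in red.
have sub r x : is_word T' r x -> is_word T r x.
  by case=> rT' rx; split=> // y /rT'; apply: subsetP.
have len_le x : x \in <<T'>>%g -> (word_length T x <= word_length T' x)%N.
  by case/word_lengthP=> r rx <-; apply: word_length_min (sub _ _ rx).
have w_inT : w \in <<T>>%g by apply: subsetP (genS sT'T) w w_in.
have len_w : word_length T' w = word_length T w.
  apply/eqP; rewrite eqn_leq len_le // andbT.
  have [r rw szr] := word_lengthP w_inT; rewrite -szr word_length_min //.
  by split; [apply: red | case: rw].
apply/setP=> x; rewrite !absolute_interval1E //.
apply/andP/andP=> [[Tx /eqP lx] | [T'x /eqP lx]].
  have [r1 [r1T r1x] sz1] := word_lengthP Tx.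
  have [|r2 [r2T r2x] sz2] := @word_lengthP _ T (x^-1 * w)%g.
    by rewrite groupM ?groupV.
  have r12 : is_word T (r1 ++ r2) w.
    by rewrite -(mulKVg x w); apply: is_word_cat.
  have T'r : {subset r1 ++ r2 <= T'}.
    by apply: red => //; rewrite size_cat sz1 sz2.
  have w1 : is_word T' r1 x.
    by split=> // y yr; rewrite T'r // mem_cat yr.
  have w2 : is_word T' r2 (x^-1 * w)%g.
    by split=> // y yr; rewrite T'r // mem_cat yr orbT.
  split; first exact: is_word_gen w1.
  rewrite eqn_leq; apply/andP; split.
    rewrite len_w -lx -sz1 -sz2.
    exact: leq_add (word_length_min w1) (word_length_min w2).
  by rewrite -{1}(mulKVg x w) word_lengthM ?(is_word_gen w1) ?(is_word_gen w2).
have Tx : x \in <<T>>%g by apply: subsetP (genS sT'T) x T'x.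
split=> //; rewrite eqn_leq; apply/andP; split; last first.
  by rewrite -{1}(mulKVg x w) word_lengthM ?groupM ?groupV.
by rewrite -len_w -lx leq_add ?len_le ?groupM ?groupV.
Qed.

(** * Cover relations below an element lying above every reflection *)

Section AbsoluteCovers.
Local Open Scope group_scope.
Variables (gT : finGroupType) (T : {set gT}) (c : gT).
Hypotheses (T_invol : {in T, forall t, t * t = 1}) (T_norm : <<T>> \subset 'N(T)).
Hypothesis c_in : c \in <<T>>.
Hypothesis T_below : {in T, forall t, (word_length T (t * c)).+1 = word_length T c}.

Local Notation l := (word_length T).
Local Notation lt := (absolute_lt T).
Local Notation I := (absolute_interval T 1).
Implicit Types u v w x t : gT.

Lemma absolute_le_trans u v w : absolute_le T u v -> absolute_le T v w ->
  absolute_le T u w.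
Proof.
move=> /absolute_leE[Tu Tv uv] /absolute_leE[_ Tw vw]; apply/absolute_leE; split=> //.
have := @word_lengthM _ T u (u^-1 * w); rewrite mulKVg groupM ?groupV // => /(_ Tu isT).
have := @word_lengthM _ T (u^-1 * v) (v^-1 * w).
rewrite !groupM ?groupV // -mulgA mulKVg => /(_ isT isT).
by move: uv vw; move: (l (u^-1 * v)) (l (v^-1 * w)) (l (u^-1 * w)); lia.
Qed.

Lemma mem_interval1 v x : v \in <<T>> -> (x \in I v) <-> absolute_le T x v.
Proof.
move=> Tv; rewrite absolute_interval1E //; split=> [/andP[Tx /eqP e]|].
  by apply/absolute_leE.
by case/absolute_leE=> -> _ ->; rewrite eqxx.
Qed.

Lemma absolute_lt_length u v : lt u v -> (l u < l v)%N.
Proof.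
case=> /absolute_leE[Tu Tv <-] uv; rewrite -addn1 leq_add2l lt0n.
apply/eqP=> /word_length_eq0; rewrite groupM ?groupV // => /(_ isT) e.
by apply: uv; rewrite -[v](mulKVg u) e mulg1.
Qed.

(** In a cover l (u^-1 v) = 1, and t = v u^-1 is a conjugate of u^-1 v. As t is an involution, u^-1
    (t c) = v^-1 c, so the length equations for v below c and for u below t c differ by one on both
    sides. *)
Lemma absolute_coverP u v :
  [/\ u \in I c, v \in I c, lt u v
    & ~ exists2 x, x \in I c & lt u x /\ lt x v] <->
  v * u^-1 \in T /\ u \in I (v * u^-1 * c).
Proof.
split=> [[Icu Icv uv nox]|].
  have [/absolute_leE[Tu Tv luv] neuv] := uv.
  have /(mem_interval1 _ c_in)/absolute_leE[_ _ luc] := Icu.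
  have /(mem_interval1 _ c_in)/absolute_leE[_ _ lvc] := Icv.
  have Tuv : u^-1 * v \in <<T>> by rewrite groupM ?groupV.
  have luv1 : l (u^-1 * v) = 1%N.
    apply/eqP; rewrite eqn_leq andbC; have := absolute_lt_length uv.
    rewrite -luv -[X in (X < _)%N]addn0 ltn_add2l => -> /=.
    rewrite leqNgt; apply/negP=> ge2; apply: nox.
    (* A single letter a split off u^-1 v yields u a strictly between u and v. *)
    have [a [b [Ta Tb e la lb]]] := word_length_split Tuv (ltnW ge2).
    have vE : v = u * a * b by rewrite -mulgA -e mulKVg.
    have Tua : u * a \in <<T>> by rewrite groupM.
    have lx : l (u * a) = (l u).+1.
      have := word_lengthM Tu Ta; have := word_lengthM Tua Tb.
      rewrite -vE la lb; move: luv ge2; clear.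
      by move: (l u) (l v) (l (u * a)) (l (u^-1 * v)); lia.
    have xv : absolute_le T (u * a) v.
      apply/absolute_leE; split=> //; rewrite {1}vE mulKg lx lb -luv addSnnS subn1.
      by rewrite prednK // ltnW.
    have ux : absolute_le T u (u * a).
      by apply/absolute_leE; split=> //; rewrite mulKg lx la addn1.
    exists (u * a).
      by apply/(mem_interval1 _ c_in)/(absolute_le_trans xv)/(mem_interval1 _ c_in).
    split; split=> // xE; move: lx; rewrite -?xE; first by move/n_Sn.
    by rewrite xE -luv -addn1 => /addnI luv1; rewrite luv1 in ge2.
  have Tt : v * u^-1 \in T.
    have -> : v * u^-1 = (u^-1 * v) ^ u^-1 by rewrite conjgE invgK -mulgA mulKVg.
    rewrite memJ_norm; first exact: (word_length_eq1 Tuv luv1).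
    by rewrite groupV (subsetP T_norm).
  have Ttc : v * u^-1 * c \in <<T>> by rewrite groupM // mem_gen.
  split=> //; apply/(mem_interval1 _ Ttc)/absolute_leE; split=> //.
  have -> : u^-1 * (v * u^-1 * c) = v^-1 * c.
    have := T_invol Tt => e; have -> : v^-1 = u^-1 * (v * u^-1).
      by apply: (mulIg (v * u^-1)); rewrite -[RHS]mulgA e mulg1 mulKg.
    by rewrite !mulgA.
  have := T_below Tt; move: luv lvc; rewrite luv1; clear.
  by move: (l u) (l v) (l c) (l (v^-1 * c)) (l (v * u^-1 * c)); lia.
have : v = v * u^-1 * u by rewrite mulgKV.
move: (v * u^-1) => t vE [Tt].
have Ttc : t * c \in <<T>> by rewrite groupM // mem_gen.
move/(mem_interval1 _ Ttc)/absolute_leE=> [Tu _ lutc].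
have ltc := T_below Tt.
have Tv : v \in <<T>> by rewrite vE groupM // mem_gen.
have vc : v^-1 * c = u^-1 * (t * c).
  have tV : t^-1 = t by rewrite -[LHS]mulg1 -(T_invol Tt) mulKg.
  by rewrite vE invMg tV mulgA.
(* Upper bound: l t <= 1. Lower bound: l c <= l v + l (v^-1 c), where l (v^-1 c) = l c - 1 - l u. *)
have lv : l v = (l u).+1.
  have := word_lengthM (mem_gen Tt) Tu; rewrite -vE.
  have := word_length_mem Tt.
  have := @word_lengthM _ T v (v^-1 * c).
  rewrite mulKVg groupM ?groupV // => /(_ Tv isT); rewrite vc.
  move: lutc ltc; clear.
  by move: (l u) (l v) (l c) (l t) (l (u^-1 * (t * c))) (l (t * c)); lia.
have vIc : absolute_le T v c.
  by apply/absolute_leE; split=> //; rewrite vc lv -ltc -lutc addSn.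
have uv : absolute_le T u v.
  apply/absolute_leE; split=> //; rewrite lv -addn1; congr addn.
  have Tuv : u^-1 * v \in T.
    have -> : u^-1 * v = t ^ u by rewrite conjgE vE mulgA.
    by rewrite memJ_norm // (subsetP T_norm).
  apply/eqP; rewrite eqn_leq word_length_mem //= lt0n; apply/eqP => e.
  move: lv; rewrite -{1}(mulKVg u v) (word_length_eq0 (mem_gen Tuv) e) mulg1; apply: n_Sn.
split.
- exact/(mem_interval1 _ c_in)/(absolute_le_trans uv).
- exact/(mem_interval1 _ c_in).
- by split=> // e; move: lv; rewrite e; apply: n_Sn.
case=> x _ [/absolute_lt_length lux /absolute_lt_length].
by rewrite lv ltnS leqNgt lux.
Qed.

Lemma card_absolute_covers :
  #|[set p : gT * gT | `[< [/\ p.1 \in I c, p.2 \in I c, lt p.1 p.2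
      & ~ exists2 x, x \in I c & lt p.1 x /\ lt x p.2] >]]|
  = (\sum_(t in T) #|I (t * c)|)%N.
Proof.
set P := [set _ | _].
have PE p : (p \in P) = (p.2 * p.1^-1 \in T) && (p.1 \in I (p.2 * p.1^-1 * c)).
  by rewrite inE; apply/asboolP/andP=> /absolute_coverP.
rewrite -sum1_card (partition_big (fun p => p.2 * p.1^-1) (mem T)) /=; last first.
  by move=> p; rewrite PE => /andP[].
apply: eq_bigr => t Tt; rewrite sum1_card.
rewrite -(card_imset _ (f := fun u => (u, t * u))); last by move=> u v [].
apply: eq_card => -[u v]; rewrite unfold_in /= PE /=.
apply/andP/imsetP=> [[/andP[_ uI] /eqP e]|[w wI [-> ->]]].
  by exists u; rewrite -?e // mulgKV.
by rewrite mulgK Tt wI eqxx.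
Qed.

End AbsoluteCovers.

(** * The reflection representation *)

Lemma chebU_antiperiodic (K : comNzRingType) (a : K) m :
  chebU a m = 0 -> chebU a m.+1 = -1 -> forall k, chebU a (m + k) = - chebU a k.
Proof.
move=> U0 U1 k.
suff [] : chebU a (m + k) = - chebU a k /\ chebU a (m + k).+1 = - chebU a k.+1 by [].
elim: k => [|k [IH1 IH2]]; first by rewrite addn0 U0 U1 oppr0.
by rewrite addnS; split=> //; rewrite !chebUSS IH1 IH2; ring.
Qed.

Lemma chebU_linear (K : comNzRingType) (a : K) (d : nat -> K) :
  (forall k, d k.+2 = a * d k.+1 - d k) ->
  forall k, d k.+1 = d 1%N * chebU a k.+1 - d 0%N * chebU a k.
Proof.
move=> dSS k.
suff [] : d k.+1 = d 1%N * chebU a k.+1 - d 0%N * chebU a k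
    /\ d k.+2 = d 1%N * chebU a k.+2 - d 0%N * chebU a k.+1 by [].
elim: k => [|k [IH1 IH2]]; first by rewrite dSS chebUSS /=; split; ring.
by split=> //; rewrite dSS IH2 IH1 !chebUSS; ring.
Qed.

Section CartanReflection.
Variables (K : fieldType) (n : nat) (A : 'M[K]_n).
Implicit Types (x : 'rV[K]_n) (i j : 'I_n).

(** Row vectors are coordinates on the fundamental weights and matrices act on the right: [row i A]
    is the simple root a_i, and [x 0 i] is the pairing of x with its coroot. *)
Definition cartan_refl i : 'M[K]_n := 1%:M - delta_mx i 0 *m row i A.

Lemma mul_cartan_refl x i : x *m cartan_refl i = x - x 0 i *: row i A.
Proof.
rewrite /cartan_refl mulmxBr mulmx1 mulmxA -mul_scalar_mx; congr (_ - _ *m _).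
by rewrite -colE; apply/matrixP=> k l; rewrite !ord1 !mxE mulr1n.
Qed.

Lemma cartan_reflE x i j : (x *m cartan_refl i) 0 j = x 0 j - x 0 i * A i j.
Proof. by rewrite mul_cartan_refl !mxE. Qed.

Lemma row_mulmx_inj m (M N : 'M[K]_(m, n)) :
  (forall x : 'rV[K]_m, x *m M = x *m N) -> M = N.
Proof. by move=> MN; apply/row_matrixP=> i; rewrite !rowE MN. Qed.

Lemma cartan_refl_sqr i : A i i = 2 -> cartan_refl i *m cartan_refl i = 1%:M.
Proof.
move=> Aii; apply: row_mulmx_inj => x; rewrite mulmxA mulmx1.
by apply/rowP=> j; rewrite !cartan_reflE Aii; ring.
Qed.

Lemma cartan_refl_unit i : A i i = 2 -> cartan_refl i \in unitmx.
Proof. by move/cartan_refl_sqr/mulmx1_unit => []. Qed.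

End CartanReflection.

Section DihedralRelation.
Variables (K : realFieldType) (n : nat) (A : 'M[K]_n) (i j : 'I_n).
Hypotheses (Aii : A i i = 2) (Ajj : A j j = 2) (Aji : A j i = A i j).

Let alt k := if odd k then j else i.

Let altS k : A (alt k.+1) (alt k) = A i j.
Proof. by rewrite /alt /=; case: odd. Qed.

Let altD k : A (alt k) (alt k) = 2.
Proof. by rewrite /alt /=; case: odd. Qed.

Fixpoint alternate (x : 'rV[K]_n) k : 'rV[K]_n :=
  if k is k1.+1 then alternate x k1 *m cartan_refl A (alt k1) else x.

Lemma alternate_rec x k : let d k := alternate x k 0 (alt k) in
  d k.+2 = - A i j * d k.+1 - d k.
Proof.
rewrite /= cartan_reflE; have -> : alt k.+2 = alt k by rewrite /alt /= negbK.
by rewrite [X in X - _ * _]cartan_reflE altS altD; ring.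
Qed.

Lemma alternate_span x k : exists p q,
  alternate x k = x + p *: row i A + q *: row j A.
Proof.
elim: k => [|k [p [q IHk]]] /=; first by exists 0, 0; rewrite !scale0r !addr0.
rewrite mul_cartan_refl {1}IHk; set d := alternate x k 0 _.
rewrite /alt; case: odd; [exists p, (q - d) | exists (p - d), q].
  by rewrite scalerBl addrA.
by rewrite scalerBl !addrA [RHS]addrAC.
Qed.

Lemma alternate_period x m : 0 <= - A i j < 2 ->
  chebU (- A i j) m = 0 -> chebU (- A i j) m.+1 = -1 ->
  alternate x m.*2 = x.
Proof.
set a := - A i j => /andP[a_ge0 a_lt2] U0 U1.
have Uper := chebU_antiperiodic U0 U1.
have dE := chebU_linear (alternate_rec x).
have U2m : chebU a m.*2 = 0 by rewrite -addnn Uper U0 oppr0.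
have U2m1 : chebU a m.*2.+1 = 1 by rewrite -addnn -addnS Uper U1 opprK.
have yi : alternate x m.*2 0 i = x 0 i.
  case: m U0 U1 Uper U2m U2m1 => [|m] // _ _ _ U2m U2m1.
  have U2m' : chebU a m.*2.+1 = -1.
    by have := chebUSS a m.*2.+1; rewrite -doubleS U2m U2m1; lra.
  have := dE m.*2.+1; rewrite -/a -doubleS U2m U2m' mulr0 sub0r mulrN1 opprK.
  by rewrite /alt odd_double.
have yj : alternate x m.*2 0 j = x 0 j.
  have := dE m.*2; rewrite -/a U2m1 U2m mulr0 subr0 mulr1 /=.
  by rewrite !cartan_reflE /alt /= odd_double /= yi; lra.
have [p [q E]] := alternate_span x m.*2.
have Ei : 2 * p = a * q.
  move: yi; rewrite E !mxE Aii Aji /a; lra.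
have Ej : 2 * q = a * p.
  move: yj; rewrite E !mxE Ajj /a; lra.
have p0 : (2 - a) * (2 + a) * p = 0.
  have -> : (2 - a) * (2 + a) * p = 2 * (2 * p) - a * (a * p) by ring.
  by rewrite Ei -Ej; ring.
have {}p0 : p = 0.
  by apply/eqP; move/eqP: p0; rewrite !mulf_eq0 => /orP[/orP[]|] // /eqP; lra.
have q0 : q = 0 by move: Ej; rewrite p0 mulr0; lra.
by rewrite E p0 q0 !scale0r !addr0.
Qed.

End DihedralRelation.

Section GeometricRepresentation.
Variables (gT : finGroupType) (W : {group gT}) (S : {set gT}).

Definition simple (i : 'I_#|S|) : gT := enum_val i.

(* [chebU a k] is sin (k theta) / sin theta for a = 2 cos theta; here
   - A i j = 2 cos (pi / m) with m the order of s_i s_j. *)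
Definition cartan_spec (K : realFieldType) (A : 'M[K]_#|S|) : Prop :=
  [/\ forall i, A i i = 2, forall i j, A i j = A j i
    & forall i j, i != j -> let m := #[simple i * simple j]%g in
      [/\ (1 < m)%N, - A i j < 2, chebU (- A i j) m = 0, chebU (- A i j) m.+1 = -1
        & forall k, (k <= m)%N -> 0 <= chebU (- A i j) k]].

Definition geometric_rep (K : realFieldType) (A : 'M[K]_#|S|)
    (rho : gT -> 'M[K]_#|S|) : Prop :=
  [/\ rho 1%g = 1%:M, {in W &, forall x y, rho (x * y)%g = rho x *m rho y}
    & forall i, rho (simple i) = cartan_refl A i].

(** The universal property extends the assignment of reflection matrices to S; [alternate_period]
    checks the relations. *)
Lemma exists_geometric_rep (R : realType) : coxeter_system W S ->
  exists (A : 'M[R]_#|S|) rho, cartan_spec A /\ geometric_rep A rho.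
Proof.
case=> genS ordS pres.
(* The parameter depends on m only; as s_i s_j and s_j s_i have the same order, A is symmetric. *)
have /choice[a aP] : forall m, exists b : R, (1 < m)%N ->
    [/\ b < 2, chebU b m = 0, chebU b m.+1 = -1
      & forall j, (j <= m)%N -> 0 <= chebU b j].
  move=> m; have [/(@dihedral_parameter R)[b bP]|_] := ltnP 1 m; last by exists 0.
  by exists b.
have sS i : simple i \in S by apply: enum_valP.
have ss i : (simple i * simple i = 1)%g.
  by have /(congr1 (expgn (simple i))) := ordS _ (sS i); rewrite expg_order.
have sV i : ((simple i)^-1 = simple i)%g by rewrite -[LHS]mulg1 -(ss i) mulKg.
pose A : 'M[R]_#|S| := \matrix_(i, j)
  if i == j then 2 else - a #[simple i * simple j]%g.
have m_gt1 i j : i != j -> (1 < #[simple i * simple j]%g)%N.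
  move=> nij; rewrite order_gt1; apply: contra nij => /eqP e.
  by apply/eqP/enum_val_inj/(mulgI (simple i)); rewrite -/(simple j) e ss.
have AP : cartan_spec A.
  split=> [i|i j|i j nij /=]; first by rewrite mxE eqxx.
    rewrite !mxE (eq_sym j); case: eqP => // _; congr (- a _).
    by rewrite -orderV invMg !sV.
  rewrite mxE (negPf nij) opprK; have gt1 := m_gt1 _ _ nij.
  by have [a_lt2 U0 U1 Uge0] := aP _ gt1; split.
have [Aii Asym Aij] := AP.
pose r i : invertible_matrix R #|S| :=
  @exist 'M[R]_#|S| (fun A => A \in unitmx) _ (cartan_refl_unit (Aii i)).
pose f s := if [pick i | simple i == s] is Some i then r i else 1%g.
have fE i : f (simple i) = r i.
  rewrite /f; case: pickP => [j /eqP/enum_val_inj->//|/(_ i)].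
  by rewrite eqxx.
have valM (x y : invertible_matrix R #|S|) : val (x * y)%g = val x *m val y by [].
have rel : {in S &, forall s t, (f s * f t) ^+ #[s * t] = 1}%g.
  move=> s t Ss St.
  have [i ->] : exists i, s = simple i.
    by exists (enum_rank_in Ss s); rewrite /simple enum_rankK_in.
  have [j ->] : exists j, t = simple j.
    by exists (enum_rank_in St t); rewrite /simple enum_rankK_in.
  rewrite !fE; have [->|nij] := eqVneq i j.
    by rewrite ss order1 expg1; apply: val_inj; rewrite valM /= cartan_refl_sqr.
  have [gt1 lt2 U0 U1 Uge0] := Aij i j nij.
  set m := #[_]%g in gt1 U0 U1 Uge0 *; apply: val_inj.
  apply: row_mulmx_inj => x; rewrite [RHS]mulmx1.
  (* On the right, x is replaced by its image under 2m alternating reflections, which is then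
     matched with the m-th power by induction. *)
  rewrite -[RHS](@alternate_period _ _ A i j _ _ _ x m) //; last first.
    by rewrite lt2 andbT; have := Uge0 2%N gt1; rewrite /= mulr1 subr0.
  elim: (m) => [|k IHk]; first by rewrite expg0 [LHS]mulmx1.
  by rewrite expgSr !valM !mulmxA IHk /= odd_double.
have [phi phiM phiS] := pres _ f rel.
exists A, (fun x => val (phi x)); split=> //; split=> [|x y Wx Wy|i].
- have /(mulgI (phi 1%g)) -> // : (phi 1 * phi 1 = phi 1 * 1)%g.
  by rewrite -phiM ?group1 // !mulg1.
- by rewrite phiM.
by rewrite phiS // fE.
Qed.

End GeometricRepresentation.

(** * Positivity and stabilizers of dominant vectors *)

(** The parity of word length, obtained from the universal property with the group of order 2 as
    target. *)
Lemma coxeter_sign (gT : finGroupType) (W : {group gT}) (S : {set gT}) :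
  coxeter_system W S -> exists e : gT -> bool,
    {in W &, forall x y, e (x * y)%g = e x (+) e y} /\ {in S, forall s, e s}.
Proof.
case=> _ _ /(_ 'I_2 (fun=> 1%R)) [|phi phiM phiS].
  by move=> s t _ _; rewrite (_ : (_ * _)%g = 1%g) ?expg1n //; apply: val_inj.
exists (fun x => odd (phi x)); split=> [x y Wx Wy|s Ss]; last by rewrite phiS.
by rewrite phiM //= modn2 oddb oddD.
Qed.

Section Tits.
Variables (gT : finGroupType) (W : {group gT}) (S : {set gT}).
Variables (K : realFieldType) (A : 'M[K]_#|S|) (rho : gT -> 'M[K]_#|S|).
Hypothesis WS_coxeter : coxeter_system W S.
Hypothesis A_cartan : cartan_spec A.
Hypothesis rho_rep : geometric_rep W A rho.

Local Notation l := (word_length S).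
Local Notation s_ := (@simple gT S).
Implicit Types (i j : 'I_#|S|) (x y : 'rV[K]_#|S|) (u v w : gT).

Lemma coxeter_gen : <<S>>%g = W :> {set gT}. Proof. by case: WS_coxeter. Qed.

Lemma simple_mem i : s_ i \in S. Proof. exact: enum_valP. Qed.

Lemma simple_onto s : s \in S -> exists i, s = s_ i.
Proof. by move=> Ss; exists (enum_rank_in Ss s); rewrite /simple enum_rankK_in. Qed.

Lemma simple_in i : s_ i \in W.
Proof. by rewrite -coxeter_gen mem_gen // simple_mem. Qed.

Lemma simple_sqr i : (s_ i * s_ i = 1)%g.
Proof.
have [_ ordS _] := WS_coxeter.
by have /(congr1 (expgn (s_ i))) := ordS _ (simple_mem i); rewrite expg_order.
Qed.

Lemma simple_inv i : ((s_ i)^-1 = s_ i)%g.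
Proof. by rewrite -[LHS]mulg1 -(simple_sqr i) mulKg. Qed.

Lemma mul_simpleK w i : (w * s_ i * s_ i = w)%g.
Proof. by rewrite -mulgA simple_sqr mulg1. Qed.

Lemma rhoM : {in W &, forall u v, rho (u * v)%g = rho u *m rho v}.
Proof. by case: rho_rep. Qed.

Lemma rho1 : rho 1%g = 1%:M. Proof. by case: rho_rep. Qed.

Lemma rho_simple i : rho (s_ i) = cartan_refl A i. Proof. by case: rho_rep. Qed.

Lemma act_simple x w i : w \in W ->
  x *m rho (w * s_ i)%g = x *m rho w - (x *m rho w) 0 i *: row i A.
Proof.
by move=> Ww; rewrite rhoM ?simple_in // mulmxA rho_simple mul_cartan_refl.
Qed.

Lemma act_simpleE x w i j : w \in W ->
  (x *m rho (w * s_ i)%g) 0 j = (x *m rho w) 0 j - (x *m rho w) 0 i * A i j.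
Proof. by move=> Ww; rewrite act_simple // !mxE. Qed.

Lemma cartan_diag i : A i i = 2. Proof. by case: A_cartan. Qed.

Lemma cartan_sym i j : A i j = A j i. Proof. by case: A_cartan. Qed.

Lemma word_length_simple_neq w i : w \in W -> l (w * s_ i)%g != l w.
Proof.
have [e [eM eS]] := coxeter_sign WS_coxeter.
have e_odd u : u \in W -> e u = odd (l u).
  have e1 : e 1%g = false.
    by have := eM _ _ (group1 W) (group1 W); rewrite mulg1; case: (e 1%g).
  rewrite -coxeter_gen => /word_lengthP[r [rS <-] <-].
  elim: r rS => [|s r IHr] rS; first by rewrite big_nil.
  have Ss : s \in S by rewrite rS ?mem_head.
  have rS' : {subset r <= S} by move=> t rt; rewrite rS // inE rt orbT.
  have Ws : s \in W by rewrite -coxeter_gen mem_gen.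
  have Wr : (\prod_(t <- r) t)%g \in W.
    by rewrite -coxeter_gen big_seq group_prod // => t /rS' St; rewrite mem_gen.
  by rewrite big_cons eM // eS // IHr.
move=> Ww; have Wws : (w * s_ i)%g \in W by rewrite groupM ?simple_in.
apply/eqP=> E; have := e_odd _ Wws; rewrite E -e_odd // eM ?simple_in //.
by rewrite (eS _ (simple_mem i)); case: (e w).
Qed.

Lemma word_lengthM_simple w i : w \in W -> (l (w * s_ i)%g <= (l w).+1)%N.
Proof.
move=> Ww; rewrite -addn1.
apply: leq_trans (leq_add (leqnn _) (word_length_mem (simple_mem i))).
by rewrite word_lengthM ?coxeter_gen ?simple_in.
Qed.

Lemma word_length_simpleP w i : w \in W ->
  l (w * s_ i)%g = (l w).+1 \/ l w = (l (w * s_ i)%g).+1.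
Proof.
move=> Ww; have := word_lengthM_simple i Ww; have := word_length_simple_neq i Ww.
have Wws : (w * s_ i)%g \in W by rewrite groupM ?simple_in.
by have := word_lengthM_simple i Wws; rewrite mul_simpleK; lia.
Qed.

Lemma last_letter w : w \in W -> (0 < l w)%N ->
  exists i, l w = (l (w * s_ i)%g).+1.
Proof.
move=> Ww; have [|r [rS rw] szr] := @word_lengthP _ S w; first by rewrite coxeter_gen.
case/lastP: r rS rw szr => [|r s] rS rw szr; first by rewrite -szr.
have Ss : s \in S by rewrite rS // mem_rcons mem_head.
have [i si] := simple_onto Ss; move=> _; exists i.
have [|//] := word_length_simpleP i Ww.
have : is_word S r (w * s_ i)%g.
  split=> [t rt|]; first by rewrite rS // mem_rcons inE rt orbT.
  by rewrite -rw -cats1 big_cat big_seq1 /= si mul_simpleK.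
by move/word_length_min; move: szr; rewrite size_rcons; lia.
Qed.

Fixpoint alt_word i j k : gT :=
  if k is k1.+1 then (alt_word j i k1 * s_ i)%g else 1%g.

Lemma alt_word_in i j k : alt_word i j k \in W.
Proof. by elim: k i j => [|k IHk] i j /=; rewrite ?group1 // groupM ?simple_in. Qed.

Lemma word_length_alt i j k : (l (alt_word i j k) <= k)%N.
Proof.
elim: k i j => [|k IHk] i j /=; first by rewrite word_length1.
by rewrite (leq_trans (word_lengthM_simple _ (alt_word_in _ _ _))) // ltnS.
Qed.

Lemma alt_word_braid i j :
  alt_word i j #[s_ i * s_ j]%g = alt_word j i #[s_ i * s_ j]%g.
Proof.
have comm k i1 j1 : (s_ i1 * (s_ j1 * s_ i1) ^+ k = (s_ i1 * s_ j1) ^+ k * s_ i1)%g.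
  elim: k => [|k IHk]; first by rewrite !expg0 mul1g mulg1.
  by rewrite !expgS -!mulgA -IHk !mulgA.
have alt k : (alt_word i j k = alt_word j i k * (s_ j * s_ i) ^+ k)%g.
  elim: k i j => [|k IHk] i1 j1 /=; first by rewrite expg0 mulg1.
  rewrite IHk -mulgA -comm expgS -!mulgA; congr (_ * _)%g.
  by rewrite [in RHS]mulgA simple_sqr mul1g.
rewrite alt; suff -> : ((s_ j * s_ i) ^+ #[s_ i * s_ j] = 1)%g by rewrite mulg1.
by rewrite -orderV invMg !simple_inv expg_order.
Qed.

Lemma alt_word_split i j k1 k2 : exists2 u, u \in W &
  (l u <= k1)%N /\ alt_word i j (k1 + k2) = (u * alt_word i j k2)%g.
Proof.
elim: k2 i j => [|k2 IHk] i j.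
  exists (alt_word i j k1); rewrite ?alt_word_in // addn0 mulg1.
  by rewrite word_length_alt.
by have [u Wu [lu e]] := IHk j i; exists u; rewrite // addnS /= e mulgA.
Qed.

(** The m letters before the last one can be braided so as to end in s_i, which cancels the final
    s_i. *)
Lemma word_length_alt_lt i j k : i != j -> (#[s_ i * s_ j]%g <= k)%N ->
  (l (alt_word i j k.+1) <= k)%N.
Proof.
move=> nij; have [_ _ /(_ i j nij)[m_gt1 _ _ _ _]] := A_cartan.
move: (alt_word_braid i j) m_gt1; set m := #[_]%g => braid m_gt1 le_mk.
have [u Wu [lu e]] := alt_word_split j i (k - m) m.
move: e; rewrite subnK //= -braid => ->.
case: m braid m_gt1 le_mk lu => // m braid m_gt1 le_mk lu /=.
rewrite mulgA mul_simpleK.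
have := @word_lengthM _ S u (alt_word j i m).
rewrite coxeter_gen => /(_ Wu (alt_word_in _ _ _)).
have la := word_length_alt j i m; move/leq_trans; apply.
by apply: leq_trans (leq_add lu la) _; lia.
Qed.

(** Last letters s_i and s_j are stripped in turn as long as the length drops; v is the minimal
    representative of the coset of the dihedral subgroup. *)
Lemma coset_decomposition i j w : w \in W -> (l w < l (w * s_ j)%g)%N ->
  exists k v, [/\ v \in W, w = (v * alt_word i j k)%g, l w = (l v + k)%N,
    (l v < l (v * s_ i)%g)%N & (l v < l (v * s_ j)%g)%N].
Proof.
have [b] := ubnP (l w); elim: b => // b IHb in i j w *; rewrite ltnS => lwb Ww lwj.
have [lwi|] := ltnP (l w) (l (w * s_ i)%g).
  by exists 0%N, w; rewrite mulg1 addn0.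
have [->|lwi _] := word_length_simpleP i Ww; first by rewrite ltnn.
have Wwi : (w * s_ i)%g \in W by rewrite groupM ?simple_in.
have [|||k [v [Wv e lv lvj lvi]]] := IHb j i (w * s_ i)%g => //.
  by rewrite -lwi.
  by rewrite mul_simpleK -lwi.
exists k.+1, v; split=> //; last by rewrite lwi lv addnS.
by rewrite /= mulgA -e mul_simpleK.
Qed.

Definition dominant x : Prop := forall i, 0 <= x 0 i.

(** For k < m both Chebyshev coefficients are nonnegative, as positivity requires. The induction
    carries k and k + 1 together. *)
Lemma alt_word_act x i j k :
  (x *m rho (alt_word i j k)) 0 j =
    chebU (- A i j) k.+1 * x 0 (if odd k then i else j)
    + chebU (- A i j) k * x 0 (if odd k then j else i).
Proof.
suff alt2 : forall i j, (x *m rho (alt_word i j k)) 0 j =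
    chebU (- A i j) k.+1 * x 0 (if odd k then i else j)
    + chebU (- A i j) k * x 0 (if odd k then j else i)
  /\ (x *m rho (alt_word i j k.+1)) 0 j =
    chebU (- A i j) k.+2 * x 0 (if odd k then j else i)
    + chebU (- A i j) k.+1 * x 0 (if odd k then i else j).
  by case: (alt2 i j).
elim: k {i j} => [|k IHk] i j.
  rewrite /= mul1g rho1 rho_simple cartan_reflE mulmx1; split; ring.
have [E1 E2] := IHk i j; have [F1 F2] := IHk j i.
rewrite chebUSS oddS if_neg; split=> //.
  by rewrite E2 if_neg addrC.
rewrite -[alt_word _ _ _]/(alt_word j i k.+1 * s_ i)%g act_simpleE ?alt_word_in //.
rewrite F2 -[alt_word _ _ _]/(alt_word i j k * s_ j)%g act_simpleE ?alt_word_in //.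
rewrite E1 cartan_diag (cartan_sym j i) if_neg !(chebUSS _ k.+1) !(chebUSS _ k).
by case: odd; rewrite /=; ring.
Qed.

(** Let s_i be a last letter of w and write w = v d, with d alternating in s_i, s_j and v lengthened
    by both. Coordinates i and j of x v are nonnegative by induction, and d combines them with
    nonnegative Chebyshev coefficients. *)
Lemma tits w j x : w \in W -> (l w < l (w * s_ j)%g)%N -> dominant x ->
  0 <= (x *m rho w) 0 j.
Proof.
have [b] := ubnP (l w); elim: b => // b IHb in w j *; rewrite ltnS => lwb Ww lwj x_ge0.
have [lw0|lw_gt0] := posnP (l w).
  have -> : w = 1%g by apply: word_length_eq0 lw0; rewrite coxeter_gen.
  by rewrite rho1 mulmx1.
have [i lwi] := last_letter Ww lw_gt0.
have nij : i != j by apply/eqP=> e; move: lwi lwj; rewrite e; lia.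
have [k [v [Wv e lv lvi lvj]]] := coset_decomposition i Ww lwj.
have k_gt0 : (0 < k)%N.
  by case: k e {lv} => // e; move: lwi lvi; rewrite e mulg1; lia.
have [_ _ /(_ i j nij)[m_gt1 _ _ _ Uge0]] := A_cartan.
(* For k >= m the alternating end of w s_j, of k + 1 letters, would have length at most k, and w s_j
   could not be longer than w. *)
have k_lt : (k < #[s_ i * s_ j]%g)%N.
  rewrite ltnNge; apply/negP=> le_mk.
  have nji : j != i by rewrite eq_sym.
  have ordC : #[s_ j * s_ i]%g = #[s_ i * s_ j]%g.
    by rewrite -orderV invMg !simple_inv.
  have := @word_length_alt_lt j i k nji; rewrite ordC => /(_ le_mk) lalt.
  have : (l (w * s_ j)%g <= l v + l (alt_word j i k.+1))%N.
    by rewrite e -mulgA; apply: word_lengthM; rewrite coxeter_gen // (alt_word_in j i k.+1).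
  by move/(leq_trans lwj); rewrite lv ltn_add2l ltnNge lalt.
rewrite e rhoM ?alt_word_in // mulmxA alt_word_act.
have v_ge0 p : p \in [:: i; j] -> 0 <= (x *m rho v) 0 p.
  rewrite !inE => /orP[]/eqP->; apply: IHb => //; lia.
by rewrite addr_ge0 ?mulr_ge0 ?Uge0 ?v_ge0 ?(ltnW k_lt) //;
  case: odd; rewrite !inE eqxx ?orbT.
Qed.

Lemma tits_sign w j : w \in W ->
  (forall x, dominant x -> 0 <= (x *m rho w) 0 j) \/
  (forall x, dominant x -> (x *m rho w) 0 j <= 0).
Proof.
move=> Ww; have [e|e] := word_length_simpleP j Ww.
  by left=> x; apply: tits; rewrite // e.
right=> x x_ge0; have Wws : (w * s_ j)%g \in W by rewrite groupM ?simple_in.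
have := @tits (w * s_ j)%g j x Wws; rewrite mul_simpleK -e leqnn => /(_ isT x_ge0).
by rewrite act_simpleE // cartan_diag; lra.
Qed.

(** If s_i is a last letter of w, positivity for w s_i gives -y_i >= 0, hence y_i = 0; so s_i fixes
    y and the shorter w s_i still sends x to y. Thus an orbit meets the closed chamber at most once,
    and stabilizers there are parabolic. *)
Lemma dominant_stabilizer w x y : w \in W -> dominant x -> dominant y ->
  x *m rho w = y -> x = y /\ w \in <<[set s_ i | i : 'I_#|S| & x 0 i == 0]>>%g.
Proof.
have [b] := ubnP (l w); elim: b => // b IHb in w y *.
rewrite ltnS => lwb Ww x_ge0 y_ge0 xwy.
have [lw0|lw_gt0] := posnP (l w).
  have w1 : w = 1%g by apply: word_length_eq0 lw0; rewrite coxeter_gen.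
  by rewrite -xwy w1 rho1 mulmx1 group1.
have [i lwi] := last_letter Ww lw_gt0.
have Wws : (w * s_ i)%g \in W by rewrite groupM ?simple_in.
have xw_ge0 : 0 <= (x *m rho (w * s_ i)%g) 0 i.
  by apply: tits => //; rewrite mul_simpleK -lwi.
have yi : y 0 i = 0.
  apply/eqP; rewrite eq_le y_ge0 andbT.
  by move: xw_ge0; rewrite act_simpleE // cartan_diag xwy; lra.
have xwy' : x *m rho (w * s_ i)%g = y.
  by rewrite act_simple // xwy yi scale0r subr0.
have [|||||xy ws] := IHb (w * s_ i)%g y => //; first by rewrite -lwi.
split=> //; rewrite -(mul_simpleK w i) groupM //.
by apply/mem_gen/imsetP; exists i; rewrite // inE xy yi.
Qed.

(** The sum of the fundamental weights, interior to the chamber: a test point for the signs of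
    roots. *)
Definition weyl_vector : 'rV[K]_#|S| := const_mx 1.

Lemma weyl_vector_free w : w \in W -> weyl_vector *m rho w = weyl_vector -> w = 1%g.
Proof.
move=> Ww /dominant_stabilizer[]// => [i|i|_]; rewrite ?mxE ?ler01 //.
suff -> : [set s_ i | i : 'I_#|S| & weyl_vector 0 i == 0] = set0.
  by rewrite gen0 => /set1gP.
by apply/setP=> z; rewrite in_set0; apply/imsetP=> [[i]]; rewrite inE mxE oner_eq0.
Qed.

Lemma rho_inj : {in W &, injective rho}.
Proof.
move=> u v Wu Wv uv; apply/eqP; rewrite eq_mulgV1; apply/eqP/weyl_vector_free.
  by rewrite groupM ?groupV.
by rewrite rhoM ?groupV // uv -rhoM ?groupV // mulgV rho1 mulmx1.
Qed.

End Tits.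

(** * The invariant form *)

Section InvariantForm.
Variables (gT : finGroupType) (W : {group gT}) (S : {set gT}).
Variables (K : realFieldType) (A : 'M[K]_#|S|) (rho : gT -> 'M[K]_#|S|).
Hypothesis WS_coxeter : coxeter_system W S.
Hypothesis A_cartan : cartan_spec A.
Hypothesis rho_rep : geometric_rep W A rho.
Hypothesis WS_irreducible : coxeter_irreducible S.

Local Notation s_ := (@simple gT S).
Implicit Types (i j : 'I_#|S|) (x y z : 'rV[K]_#|S|) (u v w : gT).

Let rhoM := rhoM rho_rep.
Let rho1 := rho1 rho_rep.
Let rhoS := rho_simple rho_rep.
Let Aii := cartan_diag A_cartan.
Let Asym := cartan_sym A_cartan.

(** Put a = - A i j. For m = 2, [chebU a 2] = a vanishes; for m >= 3, [chebU a 3] = a^2 - 1 >= 0 and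
    a >= 0 force a >= 1. *)
Lemma cartan_off_diag i j : i != j -> A i j = 0 \/ A i j <= -1.
Proof.
move=> nij; have [_ _ /(_ i j nij)[m_gt1 _ Um _ Uge0]] := A_cartan.
have := Uge0 2%N m_gt1; rewrite /= mulr1 subr0 => a_ge0.
case: (ltngtP #[s_ i * s_ j]%g 2) => [|m_gt2|m2]; first by lia.
  by right; have := Uge0 3%N m_gt2; rewrite /= mulr1 subr0; nra.
by left; move: Um; rewrite m2 /=; lra.
Qed.

Lemma cartan_off_diag_le0 i j : i != j -> A i j <= 0.
Proof. by move=> /cartan_off_diag[->|]; lra. Qed.

Lemma cartan0_commute i j : A i j = 0 -> (s_ i * s_ j = s_ j * s_ i)%g.
Proof.
move=> Aij0; have nij : i != j by apply/eqP=> e; move: Aij0; rewrite e Aii; lra.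
have [_ _ /(_ i j nij)[m_gt1 _ Um _ Uge0]] := A_cartan.
have m2 : #[s_ i * s_ j]%g = 2%N.
  case: (ltngtP #[s_ i * s_ j]%g 2) => // [|m_gt2]; first by lia.
  by exfalso; have := Uge0 3%N m_gt2; rewrite /= Aij0; lra.
apply/(mulIg (s_ i * s_ j)%g).
have := expg_order (s_ i * s_ j)%g; rewrite m2 expgS expg1 => ->.
by rewrite mulgA (mul_simpleK WS_coxeter) (simple_sqr WS_coxeter).
Qed.

Lemma edge_cartan i j : coxeter_graph S (s_ i) (s_ j) -> A i j != 0.
Proof.
case/and3P=> _ _ m_ge3; apply/eqP=> Aij0.
have nij : i != j by apply/eqP=> e; move: Aij0; rewrite e Aii; lra.
have [_ _ /(_ i j nij)[_ _ _ _ Uge0]] := A_cartan.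
by have := Uge0 3%N m_ge3; rewrite /= Aij0; lra.
Qed.

Lemma irreducible_ind (P : 'I_#|S| -> Prop) :
  (forall i j, A i j != 0 -> P i -> P j) -> forall i j, P i -> P j.
Proof.
move=> PA i j Pi; have [_ /(_ _ _ (simple_mem i) (simple_mem j))] := WS_irreducible.
case/connectP=> p; elim: p i Pi => [|t p IHp] i Pi /=.
  by move=> _ /enum_val_inj->.
case/andP=> it pt lst; have [_ St _] := and3P it.
have [k tk] := simple_onto St; rewrite tk in it pt lst.
by apply: IHp pt lst; apply: PA Pi; apply: edge_cartan.
Qed.

(** The standard scalar product summed over W: invariant by reindexing, and positive definite
    because the term of the identity is. *)
Definition iform_mx : 'M[K]_#|S| := \sum_(w in W) rho w *m (rho w)^T.

Definition iform x y : K := (x *m iform_mx *m y^T) 0 0.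

Lemma iform_act x y w : w \in W -> iform (x *m rho w) (y *m rho w) = iform x y.
Proof.
move=> Ww; rewrite /iform trmx_mul !mulmxA.
suff E : rho w *m iform_mx *m (rho w)^T = iform_mx.
  by rewrite -[in RHS]E !mulmxA.
rewrite /iform_mx mulmx_sumr mulmx_suml [RHS](reindex_inj (mulgI w)) /=.
apply: eq_big => [v|v Wv]; first by rewrite groupMl.
by rewrite rhoM // trmx_mul !mulmxA.
Qed.

Lemma iformC x y : iform x y = iform y x.
Proof.
have symG : iform_mx^T = iform_mx.
  rewrite /iform_mx raddf_sum; apply: eq_bigr => w _.
  by rewrite /= trmx_mul trmxK.
have -> : iform x y = ((y *m iform_mx *m x^T)^T) 0 0.
  by rewrite !trmx_mul trmxK symG mulmxA.
by rewrite mxE.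
Qed.

Lemma iformBl x y z : iform (x - y) z = iform x z - iform y z.
Proof. by rewrite /iform !mulmxBl !mxE. Qed.

Lemma iformZl k x z : iform (k *: x) z = k * iform x z.
Proof. by rewrite /iform -!scalemxAl mxE. Qed.

Lemma iformZr k x z : iform x (k *: z) = k * iform x z.
Proof. by rewrite iformC iformZl iformC. Qed.

Lemma iformBr x y z : iform x (y - z) = iform x y - iform x z.
Proof. by rewrite iformC iformBl !(iformC x). Qed.

Lemma iformNr x z : iform x (- z) = - iform x z.
Proof. by rewrite -scaleN1r iformZr mulN1r. Qed.

Lemma iform_sumr I (r : seq I) (P : pred I) x (F : I -> 'rV[K]_#|S|) :
  iform x (\sum_(k <- r | P k) F k) = \sum_(k <- r | P k) iform x (F k).
Proof. by rewrite /iform [(\sum_(k <- r | P k) F k)^T]linear_sum mulmx_sumr summxE. Qed.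

Lemma iform_gt0 x : x != 0 -> 0 < iform x x.
Proof.
move=> x_neq0; rewrite /iform /iform_mx mulmx_sumr mulmx_suml summxE.
have sq w : (x *m (rho w *m (rho w)^T) *m x^T) 0 0 = \sum_i ((x *m rho w) 0 i) ^+ 2.
  rewrite !mulmxA -mulmxA -trmx_mul mxE; apply: eq_bigr => i _.
  by rewrite [X in _ * X]mxE.
rewrite (bigD1 1%g) //= sq rho1 mulmx1.
have [i xi] : exists i, x 0 i != 0.
  apply/existsP; rewrite -negb_forall; apply: contra x_neq0 => /forallP x0.
  by apply/eqP/rowP=> i; rewrite mxE; apply/eqP.
apply: ltr_pwDl; last first.
  by apply: sumr_ge0 => w _; rewrite sq; apply: sumr_ge0 => k _; apply: sqr_ge0.
rewrite (bigD1 i) //= ltr_pwDl // ?exprn_even_gt0 //.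
by apply: sumr_ge0 => k _; apply: sqr_ge0.
Qed.

(** Invariance under s_i, which negates a_i, equates <x - x_i a_i, -a_i> with <x, a_i>. *)
Lemma iform_root x i : 2 * iform x (row i A) = x 0 i * iform (row i A) (row i A).
Proof.
have aE : row i A *m rho (s_ i) = - row i A.
  rewrite rhoS mul_cartan_refl mxE Aii.
  by rewrite scaler_nat mulr2n opprD addrA subrr sub0r.
have := iform_act x (row i A) (simple_in WS_coxeter i).
rewrite aE rhoS mul_cartan_refl iformNr iformBl iformZl; lra.
Qed.

Lemma root_neq0 i : row i A != 0.
Proof.
apply/eqP=> /rowP/(_ i); rewrite !mxE Aii; lra.
Qed.

(** Symmetry of A and of the form gives A j k (<a_k, a_k> - <a_j, a_j>) = 0, so the norm is constant
    along edges, hence everywhere by irreducibility. *)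
Lemma iform_norm : exists2 q, 0 < q & forall i, iform (row i A) (row i A) = q.
Proof.
have [/set0Pn[s /simple_onto[i0 _]] _] := WS_irreducible.
exists (iform (row i0 A) (row i0 A)); first exact: iform_gt0 (root_neq0 i0).
move=> i; pose P j := iform (row j A) (row j A) = iform (row i0 A) (row i0 A).
apply: (@irreducible_ind P _ i0 i); last by [].
move=> j k Ajk; rewrite /P => <-; apply: (mulfI Ajk).
have := iform_root (row j A) k; rewrite iformC iform_root !mxE (Asym k j).
by move=> ->.
Qed.

Lemma iform_root_norm q : (forall i, iform (row i A) (row i A) = q) ->
  forall x i, 2 * iform x (row i A) = q * x 0 i.
Proof. by move=> qE x i; rewrite iform_root qE mulrC. Qed.

(** Since 2 <x, a_i> = q x_i, the form yields an explicit inverse of the transpose of A. *)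
Lemma cartan_unit : A \in unitmx.
Proof.
have [q q_gt0 /iform_root_norm qE] := iform_norm; rewrite -unitmx_tr.
suff /mulmx1_unit[] : (2 / q *: iform_mx) *m A^T = 1%:M by [].
apply: row_mulmx_inj => x; rewrite mulmx1; apply/rowP=> i.
have iformE : iform x (row i A) = (x *m iform_mx *m A^T) 0 i.
  by rewrite /iform !mxE; apply: eq_bigr => k _; rewrite !mxE.
have E := qE x i; rewrite iformE in E.
rewrite -scalemxAl -scalemxAr mulmxA [LHS]mxE.
by rewrite mulrAC E mulrAC mulfV ?gt_eqF // mul1r.
Qed.

(** If every vertex of J had two neighbours in J, the sum v of the simple roots of J would have
    coordinates at most 2 - 2 = 0 on J, so <v, v> <= 0 and v = 0, against the independence of the
    simple roots. The Coxeter graph is thus a forest. *)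
Lemma exists_leaf (J : {set 'I_#|S|}) : J != set0 ->
  exists2 i, i \in J & (#|[set j in J | (j != i) && (A i j != 0%R)]| <= 1)%N.
Proof.
move=> J0; have [q q_gt0 /iform_root_norm qE] := iform_norm.
apply: contrapT => noleaf; pose v : 'rV[K]_#|S| := \sum_(i in J) row i A.
have v_le0 i : i \in J -> v 0 i <= 0.
  move=> Ji; rewrite /v summxE (bigD1 i) //= mxE Aii.
  set N := [set j in J | (j != i) && (A i j != 0)].
  have N_ge2 : (2 <= #|N|)%N.
    by rewrite ltnNge; apply/negP=> N1; apply: noleaf; exists i.
  have : \sum_(j in J | j != i) row j A 0 i <= \sum_(j in N) (-1).
    rewrite (bigID (fun j => A i j != 0)) /= [X in _ + X]big1 => [|j].
      rewrite addr0; under eq_bigl => j do rewrite -andbA.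
      under [leRHS]eq_bigl => j do rewrite inE.
      apply: ler_sum => j /and3P[_ nji Aij].
      rewrite mxE Asym; rewrite eq_sym in nji.
      by have [e|] := cartan_off_diag nji => //; rewrite e eqxx in Aij.
    by rewrite negbK mxE Asym => /andP[_ /eqP].
  rewrite sumr_const mulNrn.
  have : 2 <= #|N|%:R :> K by rewrite ler_nat.
  lra.
have v0 : v = 0.
  apply/eqP; apply: contrapT => /negP/iform_gt0.
  rewrite -(pmulr_rgt0 _ (ltr0n K 2)) {2}/v iform_sumr mulr_sumr.
  under eq_bigr => i _ do rewrite qE.
  by rewrite ltNge sumr_le0 // => i Ji; rewrite pmulr_rle0 // v_le0.
pose e : 'rV[K]_#|S| := \row_i (i \in J)%:R.
have : e *m A = 0.
  rewrite -v0 mulmx_sum_row /v [RHS]big_mkcond; apply: eq_bigr => i _.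
  by rewrite mxE; case: (i \in J); rewrite ?scale1r ?scale0r.
move/(congr1 (mulmx^~ (invmx A))); rewrite mul0mx mulmxK ?cartan_unit //.
have [i Ji] := set0Pn _ J0.
by move/rowP/(_ i)/eqP; rewrite !mxE Ji oner_eq0.
Qed.

End InvariantForm.

(** * Conjugacy of Coxeter elements *)

Section Flips.
Local Open Scope group_scope.
Variables (gT : finGroupType) (I : finType) (s : I -> gT).
Implicit Types (x y z : I) (a b c p q r : seq I).

Let comm x y := s x * s y == s y * s x.

(** Moves between words of Coxeter elements: a rotation conjugates the product, a commutation
    preserves it. *)
Inductive flips : seq I -> seq I -> Prop :=
| flips_refl r : flips r r
| flips_sym p q : flips p q -> flips q p
| flips_trans p q r : flips p q -> flips q r -> flips p r
| flips_rot x r : flips (x :: r) (rcons r x)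
| flips_comm a x y b : comm x y -> flips (a ++ x :: y :: b) (a ++ y :: x :: b).

Lemma flips_perm p q : flips p q -> perm_eq p q.
Proof.
elim=> {p q} [r|p q _|p q r _ pq _ qr|x r|a x y b _] //.
- by rewrite perm_sym.
- exact: perm_trans pq qr.
- by rewrite perm_sym perm_rcons.
by rewrite perm_cat2l (perm_catCA [:: x] [:: y] b).
Qed.

Lemma flips_letters p q : flips p q -> [set s x | x in p] = [set s x | x in q].
Proof.
move=> /flips_perm pq; apply/setP=> z.
apply/imsetP/imsetP=> [] [x xp ->]; exists x => //.
  by rewrite -(perm_mem pq).
by rewrite (perm_mem pq).
Qed.

Lemma flips_conj p q : flips p q ->
  exists2 g, g \in <<[set s x | x in p]>>
    & \prod_(x <- q) s x = (\prod_(x <- p) s x) ^ g.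
Proof.
elim=> {p q} [r|p q pq [g pg e]|p q r pq [g pg e] qr [h qh f]|x r|a x y b /eqP xy].
- by exists 1; rewrite ?group1 ?conjg1.
- exists g^-1; last by rewrite e conjgK.
  by rewrite groupV -(flips_letters pq).
- exists (g * h); last by rewrite f e conjgM.
  by rewrite groupM // (flips_letters pq).
- exists (s x); first by apply/mem_gen/imset_f; rewrite mem_head.
  by rewrite -cats1 big_cat big_seq1 big_cons conjgE !mulgA mulVg mul1g.
exists 1; rewrite ?group1 // conjg1 !big_cat /= !big_cons.
by congr (_ * _); rewrite !mulgA xy.
Qed.

Lemma flips_move x a b c : all (comm x) a -> flips (c ++ a ++ x :: b) (c ++ x :: a ++ b).
Proof.
elim: a c => [|y a IHa] c /=; first by move=> _; apply: flips_refl.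
case/andP=> xy xa; apply: (@flips_trans _ (c ++ y :: x :: a ++ b)).
  by have := IHa (rcons c y) xa; rewrite !cat_rcons.
by apply: flips_comm; rewrite /comm eq_sym.
Qed.

Let leaf x p := {in p &, forall y z, ~~ comm x y -> ~~ comm x z -> y = z}.

(** With at most one noncommuting letter, x commutes with all of a or with all of b: it moves to the
    front through a, or to the end through b and around by rotation. *)
Lemma flips_front x a b : uniq (a ++ b) -> leaf x (a ++ b) ->
  flips (a ++ x :: b) (x :: a ++ b).
Proof.
move=> ab_uniq xab; case xa: (all (comm x) a).
  exact: (@flips_move x a b [::]).
have xb : all (comm x) b.
  have [y ya nxy] : exists2 y, y \in a & ~~ comm x y.
    by apply/allPn; rewrite xa.
  apply/allP=> z zb; apply: contraTT ab_uniq => nxz.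
  rewrite cat_uniq; apply/and3P=> [[_ /hasPn/(_ z zb) za _]].
  by move: za; rewrite /= -(xab y z) ?mem_cat ?ya ?zb ?orbT.
apply: (@flips_trans _ (rcons (a ++ b) x)); last exact/flips_sym/flips_rot.
by apply: flips_sym; have := @flips_move x b [::] a xb; rewrite -cats1 -catA cats0.
Qed.

(** A new first letter does not hinder commutations. When y is rotated, either x commutes with y, or
    y is the only obstacle and x commutes with the rest. *)
Lemma flips_cons x p q : flips p q -> uniq p -> leaf x p -> flips (x :: p) (x :: q).
Proof.
move=> pq; elim: pq => {p q} [r|p q pq IH|p q r pq IHp qr IHq|y r|a y z b yz].
- by move=> _ _; apply: flips_refl.
- move=> uq xq; apply/flips_sym/IH; first by rewrite (perm_uniq (flips_perm pq)).
  by move=> y z; rewrite !(perm_mem (flips_perm pq)); apply: xq.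
- move=> up xp; apply: (flips_trans (IHp up xp)); apply: IHq.
    by rewrite -(perm_uniq (flips_perm pq)).
  by move=> y z; rewrite -!(perm_mem (flips_perm pq)); apply: xp.
- move=> /= /andP[yr ur] xp; case xy: (comm x y).
    apply: (@flips_trans _ (y :: x :: r)); first exact: (@flips_comm [::]).
    exact: (@flips_rot y (x :: r)).
  have xr : all (comm x) r.
    apply/allP=> z zr; apply: contraNT yr => nxz.
    by rewrite (xp y z) ?inE ?eqxx ?zr ?orbT ?xy.
  apply: (flips_trans (flips_rot _ _)); rewrite -cats1.
  apply: (@flips_trans _ (y :: x :: r)); last exact: (@flips_rot y (x :: r)).
  by have := @flips_move x r [::] [:: y] xr; rewrite cats0.
by move=> _ _; apply: (@flips_comm (x :: a)).
Qed.

(* On a forest all orderings of the vertices differ by rotations and by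
   commutations: a leaf can be moved to the front, and does not obstruct the
   moves of the remaining vertices. *)
Lemma flips_forest :
  (forall J : {set I}, J != set0 -> exists2 x, x \in J & leaf x (enum J)) ->
  forall p q, uniq p -> perm_eq p q -> flips p q.
Proof.
move=> forest p; have [k] := ubnP (size p); elim: k p => // k IHk p; rewrite ltnS.
move=> szp q up pq; have [p0|p_gt0] := posnP (size p).
  move: pq; rewrite (size0nil p0) perm_sym => /perm_nilP ->; apply: flips_refl.
have [|x] := forest [set x in p].
  by case: p p_gt0 {szp up pq} => // x p _; apply/set0Pn; exists x; rewrite inE mem_head.
rewrite inE => px xp; have qx : x \in q by rewrite -(perm_mem pq).
case/splitPr: px szp up pq xp {p_gt0} => a b szp up pq xp.
case/splitPr: qx pq => a' b' pq.
have ab : perm_eq (a ++ b) (a' ++ b').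
  move: pq; rewrite -!cat_rcons -!cats1 -!catA perm_catCA perm_sym.
  by rewrite perm_catCA perm_cons perm_sym.
have uab : uniq (a ++ b).
  by move: up; rewrite -cat_rcons -cats1 -catA uniq_catCA => /andP[].
have lab : leaf x (a ++ b).
  move=> y z yab zab; apply: xp; rewrite mem_enum inE mem_cat inE orbCA -mem_cat.
    by rewrite yab orbT.
  by rewrite zab orbT.
apply: (flips_trans (flips_front uab lab)).
apply: flips_trans (flips_sym (@flips_front x a' b' _ _)).
- apply: flips_cons => //; apply: IHk => //.
  by move: szp; rewrite !size_cat /= addnS.
- by rewrite -(perm_uniq ab).
by move=> y z; rewrite -!(perm_mem ab); apply: lab.
Qed.

End Flips.

Section CoxeterElements.
Variables (gT : finGroupType) (W : {group gT}) (S : {set gT}).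
Variables (K : realFieldType) (A : 'M[K]_#|S|) (rho : gT -> 'M[K]_#|S|).
Hypothesis WS_coxeter : coxeter_system W S.
Hypothesis A_cartan : cartan_spec A.
Hypothesis rho_rep : geometric_rep W A rho.
Hypothesis WS_irreducible : coxeter_irreducible S.

Local Notation s_ := (@simple gT S).

Lemma simple_seq (r : seq gT) : {subset r <= S} -> exists q, r = map s_ q.
Proof.
elim: r => [|x r IHr] rS; first by exists [::].
have [i ->] := simple_onto (rS x (mem_head _ _)).
have [|q ->] := IHr; last by exists (i :: q).
by move=> y ry; rewrite rS // inE ry orbT.
Qed.

Lemma coxeter_element_word (S' : {set gT}) c : S' \subset S -> coxeter_element S' c ->
  exists r : seq 'I_#|S|, [/\ uniq r, forall i, (i \in r) = (s_ i \in S')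
    & c = (\prod_(i <- r) s_ i)%g].
Proof.
move=> S'S [r rS' ->].
have rE : {subset r <= S}.
  by move=> x; rewrite (perm_mem rS') mem_enum => /(subsetP S'S).
have [r' r'E] := simple_seq rE.
exists r'; split; last by rewrite r'E big_map.
  by apply: (@map_uniq _ _ s_); rewrite -r'E (perm_uniq rS') enum_uniq.
move=> i; rewrite -(mem_map enum_val_inj r' i) -[map _ _]r'E.
by rewrite (perm_mem rS') mem_enum.
Qed.

(** On a forest, reorderings of a word are related by flips, which conjugate within the subgroup of
    the letters. Allowing S' smaller than S covers the maximal parabolic subgroups. *)
Lemma coxeter_element_conj (S' : {set gT}) c1 c2 : S' \subset S ->
  coxeter_element S' c1 -> coxeter_element S' c2 ->
  exists2 g, g \in <<S'>>%g & c2 = (c1 ^ g)%g.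
Proof.
move=> S'S /(coxeter_element_word S'S)[r1 [u1 r1S' ->]].
move=> /(coxeter_element_word S'S)[r2 [u2 r2S' ->]].
have r12 : perm_eq r1 r2.
  by apply: uniq_perm => // i; rewrite r1S' r2S'.
have /flips_conj[g gr ->] : flips s_ r1 r2.
  apply: flips_forest u1 r12 => J.
  move=> /(exists_leaf WS_coxeter A_cartan rho_rep WS_irreducible)[i Ji Ni].
  exists i => // j k; rewrite !mem_enum => Jj Jk nij nik.
  have neigh m : m \in J -> (s_ i * s_ m)%g != (s_ m * s_ i)%g ->
      m \in [set j in J | (j != i) && (A i j != 0)].
    move=> Jm nim; rewrite inE Jm /=; apply/andP.
    split; apply/eqP=> e; case/eqP: nim; first by rewrite e.
    exact: (cartan0_commute WS_coxeter A_cartan e).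
  by apply: (card_le1_eqP Ni); apply: neigh.
exists g => //; apply: subsetP gr; rewrite gen_subG; apply/subsetP=> z.
by case/imsetP=> i; rewrite r1S' => S'i ->; apply: mem_gen.
Qed.

End CoxeterElements.

(** * Orbits of a Coxeter element on roots *)

Section CoxeterOrbits.
Variables (gT : finGroupType) (W : {group gT}) (S : {set gT}).
Variables (K : realFieldType) (A : 'M[K]_#|S|) (rho : gT -> 'M[K]_#|S|).
Hypothesis WS_coxeter : coxeter_system W S.
Hypothesis A_cartan : cartan_spec A.
Hypothesis rho_rep : geometric_rep W A rho.
Hypothesis WS_irreducible : coxeter_irreducible S.

Local Notation s_ := (@simple gT S).
Local Notation pr r := (\prod_(i <- r) s_ i)%g.
Local Notation omega i := (delta_mx 0 i : 'rV[K]_#|S|).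
Implicit Types (i j : 'I_#|S|) (x y z : 'rV[K]_#|S|) (u v w g : gT).
Implicit Types (r : seq 'I_#|S|).

Let rhoM := rhoM rho_rep.
Let rho1 := rho1 rho_rep.
Let rhoS := rho_simple rho_rep.
Let Aii := cartan_diag A_cartan.
Let sW := simple_in WS_coxeter.

Lemma prod_simple_in r : pr r \in W.
Proof. by apply: group_prod => i _; apply: sW. Qed.

Lemma rho_cancel w x : w \in W -> x *m rho w *m rho w^-1%g = x.
Proof. by move=> Ww; rewrite -mulmxA -rhoM ?groupV // mulgV rho1 mulmx1. Qed.

Lemma rho_cancelV w x : w \in W -> x *m rho w^-1%g *m rho w = x.
Proof. by move=> Ww; rewrite -mulmxA -rhoM ?groupV // mulVg rho1 mulmx1. Qed.

Lemma act_inj w : w \in W -> injective (fun x => x *m rho w).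
Proof. by move=> Ww x y /(congr1 (mulmx^~ (rho w^-1%g))); rewrite !rho_cancel. Qed.

Lemma fix_gen (B : {set gT}) x w : B \subset W ->
  (forall b, b \in B -> x *m rho b = x) -> w \in <<B>>%g -> x *m rho w = x.
Proof.
move=> /subsetP BW xB /gen_is_word[r [rB <-]].
elim: r rB => [|b r IHr] rB; first by rewrite big_nil rho1 mulmx1.
have Bb : b \in B by rewrite rB ?mem_head.
have rB' : {subset r <= B} by move=> t rt; rewrite rB // inE rt orbT.
have Wr : (\prod_(t <- r) t)%g \in W.
  by rewrite big_seq group_prod // => t /rB'/BW.
by rewrite big_cons rhoM ?(BW _ Bb) // mulmxA xB // IHr.
Qed.

Lemma omegaE i j : omega i 0 j = (j == i)%:R.
Proof. by rewrite mxE eqxx. Qed.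

Lemma omega_dominant i : dominant (omega i).
Proof. by move=> j; rewrite omegaE ler0n. Qed.

Lemma omega_simple i j : i != j -> omega i *m rho (s_ j) = omega i.
Proof.
by move=> nij; rewrite rhoS mul_cartan_refl omegaE eq_sym (negPf nij) scale0r subr0.
Qed.

Lemma omega_word i r : i \notin r -> omega i *m rho (pr r) = omega i.
Proof.
elim: r => [|j r IHr]; first by rewrite big_nil rho1 mulmx1.
rewrite inE negb_or => /andP[nij ir].
by rewrite big_cons rhoM ?prod_simple_in ?sW // mulmxA omega_simple // IHr.
Qed.

Lemma word_span r x : exists2 k : 'rV[K]_#|S|,
  (forall i, i \notin r -> k 0 i = 0) & x - x *m rho (pr r) = k *m A.
Proof.
elim: r x => [|j r IHr] x.
  by exists 0; [move=> i _; rewrite mxE | rewrite big_nil rho1 mulmx1 subrr mul0mx].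
have [k k0 kE] := IHr (x *m rho (s_ j)); exists (x 0 j *: omega j + k).
  move=> i; rewrite inE negb_or => /andP[nij /k0 ki].
  by rewrite mxE ki addr0 mxE omegaE (negPf nij) mulr0.
have e : x 0 j *: row j A + x *m rho (s_ j) = x.
  by rewrite rhoS mul_cartan_refl addrC subrK.
rewrite big_cons rhoM ?prod_simple_in ?sW // mulmxA mulmxDl -kE -scalemxAl -rowE.
by rewrite [RHS]addrA e.
Qed.

(** The letters being distinct, the root of the first letter j enters x - x w only through x_j a_j;
    independence of the simple roots gives x_j = 0, and the induction goes on. *)
Lemma fix_word r x : uniq r -> x *m rho (pr r) = x -> forall i, i \in r -> x 0 i = 0.
Proof.
elim: r => [|j r IHr] //= /andP[jr ur]; rewrite big_cons rhoM ?prod_simple_in ?sW //.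
rewrite mulmxA => xE; have [k k0 kE] := word_span r (x *m rho (s_ j)).
have e : (x 0 j *: omega j + k) *m A = 0.
  by rewrite mulmxDl -kE xE -scalemxAl -rowE rhoS mul_cartan_refl addrC addrAC subrK subrr.
have xj : x 0 j = 0.
  have uA := cartan_unit WS_coxeter A_cartan rho_rep WS_irreducible.
  move/(congr1 (mulmx^~ (invmx A))): e; rewrite mul0mx mulmxK // => /rowP/(_ j).
  by rewrite mxE k0 // addr0 mxE omegaE eqxx mulr1 mxE.
have xjE : x *m rho (s_ j) = x by rewrite rhoS mul_cartan_refl xj scale0r subr0.
by move=> i; rewrite inE => /predU1P[->//|]; apply: IHr; rewrite // -{1}xjE.
Qed.

(** Coordinate i of x v^-1 is a positive multiple of <x, a_i v>, so the hypotheses say that the root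
    a_i v is negative and a_i v s_j positive. Only a_j and -a_j change sign under s_j. *)
Lemma root_sign_change v i j : v \in W ->
  (weyl_vector S K *m rho v^-1%g) 0 i < 0 ->
  0 < (weyl_vector S K *m rho (v * s_ j)^-1%g) 0 i ->
  row i A *m rho v = - row j A.
Proof.
move=> Wv neg pos; have rho_ge0 : dominant (weyl_vector S K).
  by move=> k; rewrite mxE ler01.
have Wvs : (v * s_ j)%g \in W by rewrite groupM.
have WvV : (v^-1)%g \in W by rewrite groupV.
have psi_le0 k : (omega k *m rho v^-1%g) 0 i <= 0.
  have [/(_ _ rho_ge0)|] := tits_sign WS_coxeter A_cartan rho_rep i WvV.
    by move: neg; lra.
  by apply; apply: omega_dominant.
have psi_ge0 k : k != j -> 0 <= (omega k *m rho v^-1%g) 0 i.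
  move=> nkj; move: pos; rewrite invMg (simple_inv WS_coxeter) => pos.
  have [|/(_ _ rho_ge0)] := tits_sign WS_coxeter A_cartan rho_rep i (groupM (sW j) WvV).
    by move/(_ _ (omega_dominant k)); rewrite rhoM // mulmxA omega_simple.
  by move: pos; lra.
(* The two bounds kill the values at all weights but omega_j, so the functional is kap times
   coordinate j and a_i v = kap a_j. Equal norms and kap <= 0 leave kap = -1. *)
set kap := (omega j *m rho v^-1%g) 0 i.
have psiE x : (x *m rho v^-1%g) 0 i = kap * x 0 j.
  rewrite mxE (bigD1 j) //= big1 => [|k nkj].
    by rewrite addr0 mulrC /kap -rowE mxE.
  have := psi_le0 k; have := psi_ge0 k nkj; rewrite -rowE mxE => p1 p2.
  have -> : rho v^-1%g k i = 0 by lra.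
  by rewrite mulr0.
have [q q_gt0 qN] := iform_norm WS_coxeter A_cartan rho_rep WS_irreducible.
have qE := iform_root_norm WS_coxeter A_cartan rho_rep qN.
have ortho x : iform W rho x (row i A *m rho v - kap *: row j A) = 0.
  rewrite iformBr iformZr -[X in iform W rho X (_ *m _)](rho_cancelV x Wv).
  rewrite (iform_act rho_rep) //.
  have := qE (x *m rho v^-1%g) i; have := qE x j; rewrite psiE; nra.
have vE : row i A *m rho v = kap *: row j A.
  apply/eqP; rewrite -subr_eq0; apply/negPn/negP=> /(iform_gt0 rho_rep).
  by rewrite ortho ltxx.
have kap_le0 : kap <= 0 by apply: psi_le0.
have kap2 : (kap - 1) * (kap + 1) = 0.
  have := qN i; rewrite -(iform_act rho_rep _ _ Wv) vE iformZl iformZr qN => e.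
  apply: (mulIf (lt0r_neq0 q_gt0)); rewrite mul0r.
  have -> : (kap - 1) * (kap + 1) * q = kap * (kap * q) - q by ring.
  by rewrite e subrr.
rewrite vE; have -> : kap = -1.
  by move/eqP: kap2; rewrite mulf_eq0 => /orP[]/eqP kapE; move: kap_le0; lra.
by rewrite scaleN1r.
Qed.

Lemma reflection_act x w i : w \in W ->
  x *m rho (s_ i ^ w)%g = x - (x *m rho w^-1%g) 0 i *: (row i A *m rho w).
Proof.
move=> Ww; rewrite conjgE !rhoM ?groupM ?groupV // !mulmxA rhoS mul_cartan_refl.
by rewrite mulmxBl rho_cancelV // scalemxAl.
Qed.

(** A reflection determines its root up to a scalar, which the common norm q restricts to 1 or -1.
    Conversely, the formula for a reflection in terms of the form is even in the root. *)
Lemma reflection_rootP i j u w : u \in W -> w \in W ->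
  (s_ i ^ u = s_ j ^ w)%g <->
    row i A *m rho u = row j A *m rho w \/ row i A *m rho u = - (row j A *m rho w).
Proof.
move=> Wu Ww.
have [q q_gt0 qN] := iform_norm WS_coxeter A_cartan rho_rep WS_irreducible.
have qE := iform_root_norm WS_coxeter A_cartan rho_rep qN.
have coefE k v x : v \in W ->
    q * (x *m rho v^-1%g) 0 k = 2 * iform W rho x (row k A *m rho v).
  by move=> Wv; rewrite -qE -(iform_act rho_rep _ _ Wv) rho_cancelV.
split=> [e|].
  pose b := row i A *m rho u; pose b' := row j A *m rho w.
  have bb : iform W rho b b = q by rewrite (iform_act rho_rep) // qN.
  have bb' : iform W rho b' b' = q by rewrite (iform_act rho_rep) // qN.
  have := reflection_act b i Wu; rewrite e reflection_act // => /addrI/oppr_inj.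
  have -> : (b *m rho u^-1%g) 0 i = 2.
    by apply: (mulfI (lt0r_neq0 q_gt0)); rewrite coefE // bb mulrC.
  move: ((b *m _) 0 j : K) => k kE.
  have bE : b = (k / 2) *: b'.
    rewrite mulrC -scalerA kE scalerA mulVf ?scale1r //; lra.
  have k2 : (k / 2) ^+ 2 = 1.
    move: bb; rewrite bE iformZl iformZr bb' => e2.
    by apply: (mulIf (lt0r_neq0 q_gt0)); rewrite mul1r expr2 -(mulrA (k / 2)) e2.
  rewrite -/b -/b' bE; move/eqP: k2; rewrite sqrf_eq1 => /orP[]/eqP->.
    by left; rewrite scale1r.
  by right; rewrite scaleN1r.
have actE k v x : v \in W -> q *: (x *m rho (s_ k ^ v)%g) =
    q *: x - (2 * iform W rho x (row k A *m rho v)) *: (row k A *m rho v).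
  by move=> Wv; rewrite reflection_act // scalerBr scalerA coefE.
move=> b; apply: (rho_inj WS_coxeter A_cartan rho_rep).
- by rewrite groupJ.
- by rewrite groupJ.
apply: row_mulmx_inj => x; apply: (scalerI (lt0r_neq0 q_gt0)).
rewrite !actE //.
by case: b => ->; rewrite ?iformNr ?mulrN ?scaleNr ?scalerN ?opprK.
Qed.

(** * Orbits under a Coxeter word using each simple reflection once *)

Section Orbits.
Variable r : seq 'I_#|S|.
Hypotheses (r_uniq : uniq r) (r_full : forall i, i \in r).

Local Notation c := (pr r).
Local Notation before i := (take (index i r) r).
Local Notation after i := (drop (index i r).+1 r).

(* [coxeter_omit i], [coxeter_refl i] and [coxeter_root i] are c t_i, t_i and b_i
   in the notation of the header. *)
Definition coxeter_omit i := (pr (before i) * pr (after i))%g.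
Definition coxeter_refl i := (s_ i ^ pr (after i))%g.
Definition coxeter_root i := row i A *m rho (pr (after i)).

Let Wc : c \in W := prod_simple_in r.

Lemma cycle_subW g : g \in <[c]>%g -> g \in W.
Proof. by apply: subsetP; rewrite cycle_subG. Qed.

Lemma split_word i : r = before i ++ i :: after i.
Proof.
by rewrite -{1}(cat_take_drop (index i r) r) (drop_nth i) ?index_mem // nth_index.
Qed.

Lemma prod_split i : c = (pr (before i) * s_ i * pr (after i))%g.
Proof. by rewrite {1}(split_word i) big_cat big_cons /= mulgA. Qed.

Lemma coxeter_omitE i : (c * coxeter_refl i = coxeter_omit i)%g.
Proof.
rewrite (prod_split i) /coxeter_refl conjgE /coxeter_omit !mulgA mulgK.
by rewrite (mul_simpleK WS_coxeter).
Qed.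

Lemma notin_before i : i \notin before i.
Proof.
move: r_uniq; rewrite {1}(split_word i) cat_uniq /= => /and3P[_].
by rewrite negb_or => /andP[].
Qed.

Lemma notin_after i : i \notin after i.
Proof.
by move: r_uniq; rewrite {1}(split_word i) cat_uniq /= => /and4P[].
Qed.

Lemma omega_coxeter i : omega i *m rho c = omega i - coxeter_root i.
Proof.
rewrite {1}(prod_split i) !rhoM ?groupM ?prod_simple_in // !mulmxA.
rewrite omega_word ?notin_before // rhoS mul_cartan_refl omegaE eqxx scale1r.
by rewrite mulmxBl omega_word ?notin_after.
Qed.

Lemma coxeter_fix0 x : x *m rho c = x -> x = 0.
Proof.
by move=> xc; apply/rowP=> i; rewrite mxE (fix_word r_uniq xc).
Qed.

Lemma cycle_fix_coxeter x y g : g \in <[c]>%g ->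
  y *m rho g = y -> y *m rho c *m rho g = y *m rho c.
Proof.
case/cycleP=> k -> yg; rewrite -mulmxA -rhoM ?groupX ?Wc // -expgS expgSr.
by rewrite rhoM ?groupX ?Wc // mulmxA yg.
Qed.

(* With [y] the vector of entries - A i j (j != i) and 0 at i, one has
   omega_i + omega_i c = y (after i), so that [g] conjugated by [after i] fixes
   the dominant vector [y], hence lies in the parabolic subgroup generated by the
   non-neighbours of i; and omega_j (after i) is omega_j or omega_j c. *)
Lemma cycle_fix_neighbour g i j : g \in <[c]>%g -> A i j != 0 ->
  omega i *m rho g = omega i -> omega j *m rho g = omega j.
Proof.
move=> cg Aij gi; have [<-//|nij] := eqVneq i j.
have Wg := cycle_subW cg; have Wp := prod_simple_in (after i); set p := pr (after i) in Wp.
pose y := 2 *: omega i - row i A.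
have yE k : y 0 k = if k == i then 0 else - A i k.
  rewrite !mxE eqxx eq_sym; case: eqVneq => [<-|_]; first by rewrite Aii mulr1 subrr.
  by rewrite mulr0 sub0r.
have y_dom : dominant y.
  move=> k; rewrite yE; case: eqVneq => // nki.
  by rewrite oppr_ge0 cartan_off_diag_le0 // eq_sym.
have yp : y *m rho p = omega i + omega i *m rho c.
  rewrite omega_coxeter /coxeter_root -/p mulmxBl -scalemxAl omega_word ?notin_after //.
  by rewrite scaler_nat mulr2n addrA.
have ypg : y *m rho p *m rho g = y *m rho p.
  by rewrite yp mulmxDl gi cycle_fix_coxeter.
have Wpgp : (p * g * p^-1)%g \in W by rewrite !groupM ?groupV.
have ypgp : y *m rho (p * g * p^-1)%g = y.
  by rewrite !rhoM ?groupM ?groupV // !mulmxA ypg rho_cancel.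
have [_ stab] := dominant_stabilizer WS_coxeter A_cartan rho_rep Wpgp y_dom y_dom ypgp.
have jpgp : omega j *m rho (p * g * p^-1)%g = omega j.
  apply: fix_gen stab => [|b /imsetP[k]].
    by apply/subsetP=> b /imsetP[k _ ->].
  rewrite inE yE => yk ->; apply: omega_simple; apply: contraTneq yk => <-.
  by rewrite (eq_sym j) (negPf nij) oppr_eq0.
have jpg : omega j *m rho p *m rho g = omega j *m rho p.
  apply: (act_inj (w := p^-1%g)); rewrite ?groupV //= rho_cancel //.
  by rewrite -[RHS]jpgp !rhoM ?groupM ?groupV // !mulmxA.
have [ja|ja] := boolP (j \in after i); last by rewrite omega_word in jpg.
have jc : omega j *m rho p = omega j *m rho c.
  have jb : j \notin before i.
    apply: contraTN r_uniq => jb; rewrite {1}(split_word i) cat_uniq.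
    by apply/negP=> /and3P[_ /hasPn/(_ j)]; rewrite inE ja orbT jb => /(_ isT).
  rewrite [in RHS](prod_split i) !rhoM ?groupM ?prod_simple_in // !mulmxA.
  by rewrite omega_word // omega_simple // eq_sym.
apply: (act_inj Wc); rewrite /= -[RHS]jc -jpg jc -!mulmxA -!rhoM ?Wc //.
by case/cycleP: cg => k ->; rewrite -expgS -expgSr.
Qed.

Lemma cycle_fix_omega g i : g \in <[c]>%g -> omega i *m rho g = omega i -> g = 1%g.
Proof.
move=> cg gi; have Wg := cycle_subW cg.
have fix_all : forall j, omega j *m rho g = omega j.
  move=> j; pose P k := omega k *m rho g = omega k.
  have step k l : A k l != 0 -> P k -> P l by apply: cycle_fix_neighbour.
  have ind := irreducible_ind A_cartan WS_irreducible step.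
  exact: ind gi.
apply: (rho_inj WS_coxeter A_cartan rho_rep) => //.
by apply/row_matrixP=> j; rewrite rho1 !rowE mulmx1.
Qed.

Lemma coxeter_root_inj g1 g2 i j : g1 \in <[c]>%g -> g2 \in <[c]>%g ->
  coxeter_root i *m rho g1 = coxeter_root j *m rho g2 -> i = j /\ g1 = g2.
Proof.
move=> cg1 cg2; have Wg1 := cycle_subW cg1; have Wg2 := cycle_subW cg2.
have rootE k : coxeter_root k = omega k - omega k *m rho c.
  by rewrite omega_coxeter opprB addrC subrK.
have comm k g : g \in <[c]>%g ->
    coxeter_root k *m rho g = omega k *m rho g - omega k *m rho g *m rho c.
  move=> cg; case/cycleP: cg => m ->.
  by rewrite rootE mulmxBl -!mulmxA -!rhoM ?groupX ?Wc // -expgS expgSr.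
rewrite !comm // => e.
have swap (a b a' b' : 'rV[K]_#|S|) : a - a' = b - b' -> a' - b' = a - b.
  by move=> /rowP ab; apply/rowP=> l; move: (ab l); rewrite !mxE; lra.
have e2 : omega i *m rho g1 = omega j *m rho g2.
  apply/eqP; rewrite -subr_eq0; apply/eqP/coxeter_fix0.
  by rewrite mulmxBl; apply: swap.
have Wg : (g1 * g2^-1)%g \in W by rewrite groupM ?groupV.
have gE : omega i *m rho (g1 * g2^-1)%g = omega j.
  by rewrite rhoM ?groupV // mulmxA e2 rho_cancel.
have [ij _] := dominant_stabilizer WS_coxeter A_cartan rho_rep Wg
  (omega_dominant i) (omega_dominant j) gE.
have {}ij : i = j.
  apply/eqP; move/rowP/(_ i)/eqP: ij; rewrite !omegaE eqxx.
  by case: (eqVneq i j) => //= _; rewrite oner_eq0.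
split=> //; apply/eqP; rewrite eq_mulgV1; apply/eqP.
by apply: (@cycle_fix_omega _ i); rewrite ?groupM ?groupV // gE ij.
Qed.

Lemma weyl_vector_regular w i : w \in W -> (weyl_vector S K *m rho w) 0 i != 0.
Proof.
move=> Ww; apply/eqP=> e.
have ws1 : (w * s_ i * w^-1)%g = 1%g.
  apply: (weyl_vector_free WS_coxeter A_cartan rho_rep).
    by rewrite !groupM ?groupV.
  by rewrite !rhoM ?groupM ?groupV // !mulmxA rhoS mul_cartan_refl e scale0r subr0
     rho_cancel.
have s1 : s_ i = 1%g by apply: (mulgI w); apply: (mulIg w^-1%g); rewrite ws1 mulg1 mulgV.
by have [_ /(_ _ (simple_mem i))] := WS_coxeter; rewrite s1 order1.
Qed.

(** The numbers f k, which have the signs of the roots a_i w c^k, are nonzero, periodic, and sum to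
    0 over a period; hence both signs occur. *)
Lemma orbit_sign_change w i : w \in W -> exists2 k,
  (weyl_vector S K *m rho (w * c ^+ k)^-1%g) 0 i < 0 &
  0 < (weyl_vector S K *m rho (w * c ^+ k.+1)^-1%g) 0 i.
Proof.
move=> Ww; pose f (k : nat) : K := (weyl_vector S K *m rho (w * c ^+ k)^-1%g) 0 i.
have Wwc k : (w * c ^+ k)^-1%g \in W by rewrite groupV groupM ?groupX ?Wc.
have f_neq0 k : f k != 0 by apply: weyl_vector_regular.
have fper k : f (k + #[c]%g)%N = f k.
  by rewrite /f expgD expg_order mulg1.
have fsum : \sum_(k < #[c]%g) f k = 0.
  pose x := \sum_(k < #[c]%g) weyl_vector S K *m rho (c ^- k)%g.
  have xc : x *m rho c^-1%g = x.
    rewrite /x mulmx_suml; have := order_gt0 c; case: #[c]%g (expg_order c) => // n cn _.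
    rewrite big_ord_recr [RHS]big_ord_recl /= addrC; congr (_ + _).
      by rewrite -mulmxA -rhoM ?groupV ?groupX ?Wc // -invMg -expgS cn expg0.
    apply: eq_bigr => k _.
    by rewrite -mulmxA -rhoM ?groupV ?groupX ?Wc // -invMg -expgS.
  have x0 : x = 0.
    by apply: coxeter_fix0; rewrite -{1}xc rho_cancelV ?Wc.
  have -> : \sum_(k < #[c]%g) f k = (x *m rho w^-1%g) 0 i.
    rewrite mulmx_suml summxE; apply: eq_bigr => k _.
    by rewrite /f invMg rhoM ?mulmxA ?groupV ?groupX ?Wc.
  by rewrite x0 mul0mx mxE.
have [k0 fk0] : exists k, f k < 0.
  apply: contrapT => noneg; move/eqP: fsum; apply/negP; rewrite gt_eqF //.
  have fpos k : 0 < f k.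
    by rewrite lt_def f_neq0 leNgt; apply/negP=> fk; apply: noneg; exists k.
  have := order_gt0 c; case: #[c]%g => // n _.
  by rewrite big_ord_recl ltr_pwDl // sumr_ge0 // => k _; apply: ltW.
have [k1 fk1] : exists k, 0 < f (k0 + k)%N.
  apply: contrapT => nopos; move/eqP: fsum; apply/negP; rewrite lt_eqF //.
  have fneg k : f k < 0.
    rewrite lt_def eq_sym f_neq0 leNgt; apply/negP=> fk; apply: nopos.
    have fper2 m : f (k + m * #[c]%g)%N = f k.
      by elim: m => [|m IHm]; rewrite ?addn0 // mulSn addnCA addnC fper.
    exists (k + k0 * #[c]%g - k0)%N; rewrite subnKC ?fper2 //.
    by apply: leq_trans (leq_addl _ _); rewrite leq_pmulr.
  have := order_gt0 c; case: #[c]%g => // n _.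
  by rewrite big_ord_recl ltr_nwDl // sumr_le0 // => k _; apply: ltW.
have ex : exists k, 0 < f (k0 + k)%N by exists k1.
(* As f k0 < 0, the first positive index from k0 on has the form k0 + m + 1; minimality makes f (k0
   + m) negative. *)
case: (ex_minnP ex) => -[|m] fm min_m; first by move: fm fk0; rewrite addn0; lra.
exists (k0 + m)%N; last by move: fm; rewrite addnS.
rewrite -/(f _) lt_neqAle f_neq0 /= leNgt; apply/negP=> /min_m.
by rewrite ltnn.
Qed.

(** The letters of q are applied one at a time: the root is negative at first and positive at the
    end, so some letter s_j makes a change, just before which the root is -a_j. *)
Lemma letter_sign_change q u i : u \in W ->
  (weyl_vector S K *m rho u^-1%g) 0 i < 0 ->
  0 < (weyl_vector S K *m rho (u * pr q)^-1%g) 0 i ->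
  exists a j b, q = a ++ j :: b /\ row i A *m rho (u * pr a)%g = - row j A.
Proof.
elim: q u => [|j q IHq] u Wu neg; first by rewrite big_nil mulg1; move: neg; lra.
rewrite big_cons mulgA => pos; have Wus : (u * s_ j)%g \in W by rewrite groupM.
have WusV : (u * s_ j)^-1%g \in W by rewrite groupV.
have := weyl_vector_regular i WusV; rewrite neq_lt => /orP[neg'|pos'].
  have [a [k [b [-> e]]]] := IHq _ Wus neg' pos.
  by exists (j :: a), k, b; rewrite big_cons mulgA.
exists [::], j, q; split=> //.
by rewrite big_nil mulg1; apply: root_sign_change.
Qed.

(** At the sign change the letter s_j turns -a_j into a_j, and the remaining letters of c carry it
    to b_j; thus b_j is a_i w followed by c^(k+1). *)
Lemma coxeter_root_onto w i : w \in W -> exists g j,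
  g \in <[c]>%g /\ coxeter_root j *m rho g = row i A *m rho w.
Proof.
move=> Ww; have [k neg] := orbit_sign_change i Ww.
have Wu : (w * c ^+ k)%g \in W by rewrite groupM ?groupX ?Wc.
rewrite expgSr mulgA => pos.
have [a [j [b [rE e]]]] := letter_sign_change Wu neg pos.
exists (c ^- k.+1)%g, j; rewrite groupV mem_cycle; split=> //.
have ja : j \notin a.
  by move: r_uniq; rewrite rE cat_uniq /= negb_or => /and3P[_ /andP[]].
have aj : after j = b.
  rewrite rE index_cat (negPf ja) /= eqxx addn0 -cat_rcons drop_size_cat //.
  by rewrite size_rcons.
have jE : coxeter_root j = row i A *m rho (w * c ^+ k.+1)%g.
  have -> : (w * c ^+ k.+1 = w * c ^+ k * pr a * s_ j * pr b)%g.
    by rewrite expgSr -!mulgA; congr (_ * (_ * _))%g; rewrite {1}rE big_cat big_cons.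
  rewrite !(rhoM (y := pr b)) ?groupM ?prod_simple_in ?groupX ?Wc //.
  rewrite [rho (_ * s_ j)%g]rhoM ?groupM ?prod_simple_in ?groupX ?Wc // !mulmxA.
  by rewrite e mulNmx rhoS mul_cartan_refl mxE Aii mulr2n scalerDl scale1r
    opprB addrK /coxeter_root aj.
by rewrite jE -mulmxA -rhoM ?groupV ?groupM ?groupX ?Wc // mulgK.
Qed.

End Orbits.

End CoxeterOrbits.

(** * Counting reflections *)

Section ReflectionCount.
Variables (gT : finGroupType) (W : {group gT}) (S : {set gT}).
Variables (K : realFieldType) (A : 'M[K]_#|S|) (rho : gT -> 'M[K]_#|S|).
Hypothesis WS_coxeter : coxeter_system W S.
Hypothesis A_cartan : cartan_spec A.
Hypothesis rho_rep : geometric_rep W A rho.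
Hypothesis WS_irreducible : coxeter_irreducible S.

Local Notation s_ := (@simple gT S).
Local Notation pr r := (\prod_(i <- r) s_ i)%g.
Local Notation omega i := (delta_mx 0 i : 'rV[K]_#|S|).
Local Notation T := (reflections W S).
Implicit Types (i j : 'I_#|S|) (x y z : 'rV[K]_#|S|) (t u v w g : gT).

Let rhoM := rhoM rho_rep.
Let rho1 := rho1 rho_rep.
Let rhoS := rho_simple rho_rep.
Let Aii := cartan_diag A_cartan.
Let sW := simple_in WS_coxeter.

Lemma reflectionsP t : reflect (exists i w, w \in W /\ t = s_ i ^ w)%g (t \in T).
Proof.
apply: (iffP imset2P) => [[s w Ss Ww ->]|[i [w [Ww ->]]]].
  by have [i ->] := simple_onto Ss; exists i, w.
by exists (s_ i) w; rewrite ?simple_mem.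
Qed.

Lemma reflectionsJ t w : w \in W -> (t ^ w \in T)%g = (t \in T).
Proof.
suff sub t' w' : w' \in W -> t' \in T -> (t' ^ w' \in T)%g.
  move=> Ww; apply/idP/idP; last exact: sub.
  by rewrite -[X in _ -> X \in _](conjgK w); apply: sub; rewrite groupV.
move=> Ww' /reflectionsP[i [u [Wu ->]]]; apply/reflectionsP.
by exists i, (u * w')%g; rewrite groupM // conjgM.
Qed.

Lemma simple_reflection i : s_ i \in T.
Proof. by apply/reflectionsP; exists i, 1%g; rewrite group1 conjg1. Qed.

Lemma reflectionsW t : t \in T -> t \in W.
Proof. by case/reflectionsP=> i [w [Ww ->]]; rewrite groupJ. Qed.

Lemma gen_reflections : <<T>>%g = W :> {set gT}.
Proof.
apply/eqP; rewrite eqEsubset gen_subG; apply/andP; split.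
  by apply/subsetP=> t; apply: reflectionsW.
rewrite -(coxeter_gen WS_coxeter) genS //; apply/subsetP=> s.
by case/simple_onto=> i ->; rewrite (coxeter_gen WS_coxeter) simple_reflection.
Qed.

Lemma reflections_norm : W \subset 'N(T)%g.
Proof.
apply/subsetP=> w Ww; rewrite inE; apply/subsetP=> t.
by rewrite mem_conjg -(reflectionsJ _ Ww) conjgKV.
Qed.

Lemma reflections_sqr t : t \in T -> (t * t = 1)%g.
Proof.
by case/reflectionsP=> i [w [Ww ->]]; rewrite -conjMg (simple_sqr WS_coxeter) conj1g.
Qed.

Section Count.
Variable r : seq 'I_#|S|.
Hypotheses (r_uniq : uniq r) (r_full : forall i, i \in r).
Local Notation c := (pr r).
Local Notation trefl := (coxeter_refl r).
Local Notation broot := (coxeter_root A rho r).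
Local Notation after i := (drop (index i r).+1 r).

Let Wc : c \in W := prod_simple_in WS_coxeter r.
Let cW g : g \in <[c]>%g -> g \in W := @cycle_subW _ _ _ WS_coxeter r g.

Lemma coxeter_refl_in i : trefl i \in T.
Proof. by apply/reflectionsP; exists i, (pr (after i)); rewrite prod_simple_in. Qed.

(** The two pairs correspond to the two opposite roots of t, each of which is b_j g for exactly one
    (g, j). *)
Lemma card_coxeter_refl t : t \in T ->
  #|[set p : gT * 'I_#|S| | (p.1 \in <[c]>%g) && (trefl p.2 ^ p.1 == t)%g]| = 2%N.
Proof.
case/reflectionsP=> i [w [Ww ->]].
have [gp [jp [cgp ep]]] :=
  coxeter_root_onto WS_coxeter A_cartan rho_rep WS_irreducible r_uniq r_full i Ww.
have Wsw : (s_ i * w)%g \in W by rewrite groupM.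
have [gm [jm [cgm em]]] :=
  coxeter_root_onto WS_coxeter A_cartan rho_rep WS_irreducible r_uniq r_full i Wsw.
have {}em : broot jm *m rho gm = - (row i A *m rho w).
  rewrite em rhoM // mulmxA rhoS mul_cartan_refl mxE Aii.
  by rewrite scaler_nat mulr2n opprD addrA subrr sub0r mulNmx.
have inj := coxeter_root_inj WS_coxeter A_cartan rho_rep WS_irreducible r_uniq r_full.
have hit j g : g \in <[c]>%g -> (trefl j ^ g = s_ i ^ w)%g <->
    broot j *m rho g = row i A *m rho w \/ broot j *m rho g = - (row i A *m rho w).
  move=> cg; have Wp := prod_simple_in WS_coxeter (after j).
  have Wpg := groupM Wp (cW cg).
  have := reflection_rootP WS_coxeter A_cartan rho_rep WS_irreducible j i Wpg Ww.
  by rewrite rhoM ?(cW cg) // mulmxA conjgM.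
have neq : (gp, jp) != (gm, jm).
  apply/eqP=> -[egg ejj]; move: ep; rewrite egg ejj em => /eqP.
  rewrite eq_sym -subr_eq0 opprK -mulr2n -scaler_nat scaler_eq0 pnatr_eq0 /=.
  apply/negP/eqP=> /(congr1 (mulmx^~ (rho w^-1%g))).
  by rewrite (rho_cancel rho_rep) // mul0mx; apply/eqP/(root_neq0 A_cartan).
suff -> : [set p | (p.1 \in <[c]>%g) && (trefl p.2 ^ p.1 == s_ i ^ w)%g]
    = [set (gp, jp); (gm, jm)] by rewrite cards2 neq.
apply/setP=> -[g j]; rewrite !inE /=; apply/andP/orP=> [[cg /eqP/(hit _ _ cg)]|].
  rewrite -{1}ep -em => -[] /inj[]// -> ->; [by left|by right].
by case=> /eqP[-> ->]; split=> //; apply/eqP/hit => //; [left|right].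
Qed.

(** Double counting of pairs (g, i): each reflection arises from two, and F is constant on orbits
    under c. *)
Lemma sum_reflections (F : gT -> nat) :
  (forall t, t \in T -> F (t ^ c)%g = F t) ->
  (2 * \sum_(t in T) F t = #[c]%g * \sum_i F (trefl i))%N.
Proof.
move=> Fc.
have Fg t g : t \in T -> g \in <[c]>%g -> F (t ^ g)%g = F t.
  move=> Tt /cycleP[k ->]; elim: k => [|k IHk]; first by rewrite expg0 conjg1.
  by rewrite expgSr conjgM Fc ?IHk // reflectionsJ // groupX.
pose D := [pred p : gT * 'I_#|S| | p.1 \in <[c]>%g].
transitivity (\sum_(p | D p) F (trefl p.2 ^ p.1)%g)%N.
  rewrite (partition_big (fun p => (trefl p.2 ^ p.1)%g) (mem T)) /=; last first.
    by move=> p /cW Wp; rewrite reflectionsJ // coxeter_refl_in.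
  rewrite big_distrr; apply: eq_bigr => t Tt /=.
  rewrite -(card_coxeter_refl Tt) -sum1_card big_distrl /=.
  apply: eq_big => [p|p]; first by rewrite inE.
  by rewrite inE mul1n => /andP[_ /eqP->].
transitivity (\sum_(g in <[c]>%g) \sum_i F (trefl i ^ g)%g)%N.
  by rewrite pair_big /=; apply: eq_bigl => p; rewrite andbT.
rewrite -sum_nat_const; apply: eq_bigr => g cg; apply: eq_bigr => i _.
by rewrite Fg // coxeter_refl_in.
Qed.

End Count.

End ReflectionCount.

(** * Reflection length and parabolic subgroups *)

Section ReflectionLength.
Variables (gT : finGroupType) (W : {group gT}) (S : {set gT}).
Variables (K : realFieldType) (A : 'M[K]_#|S|) (rho : gT -> 'M[K]_#|S|).
Hypothesis WS_coxeter : coxeter_system W S.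
Hypothesis A_cartan : cartan_spec A.
Hypothesis rho_rep : geometric_rep W A rho.
Hypothesis WS_irreducible : coxeter_irreducible S.

Local Notation s_ := (@simple gT S).
Local Notation pr r := (\prod_(i <- r) s_ i)%g.
Local Notation omega i := (delta_mx 0 i : 'rV[K]_#|S|).
Local Notation T := (reflections W S).
Local Notation l := (word_length T).
Implicit Types (i j : 'I_#|S|) (x y z : 'rV[K]_#|S|) (t u v w g : gT).

Let rhoM := rhoM rho_rep.
Let rho1 := rho1 rho_rep.
Let rhoS := rho_simple rho_rep.
Let sW := simple_in WS_coxeter.
Let reflW t : t \in T -> t \in W := @reflectionsW _ _ _ WS_coxeter t.
Let genT : <<T>>%g = W :> {set gT} := gen_reflections WS_coxeter.

(** The codimension of the fixed space: subadditive and at most 1 on reflections, it bounds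
    reflection length from below. *)
Definition defect w : nat := \rank (1%:M - rho w).

Lemma defectM g h : g \in W -> h \in W ->
  (defect (g * h)%g <= defect g + defect h)%N.
Proof.
move=> Wg Wh; rewrite /defect.
have -> : 1%:M - rho (g * h)%g = (1%:M - rho g) *m rho h + (1%:M - rho h).
  by rewrite mulmxBl mul1mx rhoM // [RHS]addrC addrA subrK.
by rewrite (leq_trans (mxrank_add _ _)) // leq_add2r mxrankM_maxl.
Qed.

Lemma reflection_mx i w : w \in W -> 1%:M - rho (s_ i ^ w)%g =
  rho w^-1%g *m delta_mx i (0 : 'I_1) *m (row i A *m rho w).
Proof.
move=> Ww; rewrite conjgE !rhoM ?groupM ?groupV // rhoS /cartan_refl.
rewrite mulmxBl mul1mx mulmxBr -rhoM ?groupV // mulVg rho1 opprB addrC subrK.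
by rewrite !mulmxA.
Qed.

Lemma defect_reflection t : t \in T -> (defect t <= 1)%N.
Proof.
case/reflectionsP=> i [w [Ww ->]]; rewrite /defect reflection_mx //.
by rewrite (leq_trans (mxrankM_maxl _ _)) ?rank_leq_col.
Qed.

Lemma prod_reflections r : {subset r <= T} -> (\prod_(t <- r) t)%g \in W.
Proof. by move=> rT; rewrite big_seq group_prod // => t /rT/reflW. Qed.

Lemma defect_word r w : is_word T r w -> (defect w <= size r)%N.
Proof.
case=> rT <-; elim: r rT => [|t r IHr] rT.
  by rewrite big_nil /defect rho1 subrr mxrank0.
have rT' : {subset r <= T} by move=> y ry; rewrite rT // inE ry orbT.
have Tt : t \in T by rewrite rT ?mem_head.
rewrite big_cons (leq_trans (defectM (reflW Tt) (prod_reflections rT'))) //.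
by rewrite /= -add1n leq_add ?defect_reflection ?IHr.
Qed.

(* If the first letter moved [x], its root would lie in the image of 1 - w' for
   the product w' of the other letters, so that 1 - w would have rank < size r. *)
Lemma minimal_word_fix r w x : is_word T r w -> (size r <= defect w)%N ->
  x *m rho w = x -> {in r, forall t, x *m rho t = x}.
Proof.
case=> rT <- {w}; elim: r rT x => [|t r IHr] // rT x.
have rT' : {subset r <= T} by move=> y ry; rewrite rT // inE ry orbT.
have Tt : t \in T by rewrite rT ?mem_head.
have Wt := reflW Tt; have Wr := prod_reflections rT'.
have defr : (defect (\prod_(t <- r) t)%g <= size r)%N by apply: defect_word.
rewrite big_cons /= => big_defect xw.
have xt : x *m rho t = x.
  have [i [v [Wv tE]]] := reflectionsP _ _ _ Tt.
  have := reflection_act WS_coxeter rho_rep x i Wv; rewrite -tE.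
  move: ((x *m _) 0 i : K) => k; have [->|k_neq0] := eqVneq k 0.
    by rewrite scale0r subr0.
  move=> xtE; exfalso; set w' := (\prod_(t <- r) t)%g in Wr xw defr big_defect.
  have b_sub : (row i A *m rho v <= 1%:M - rho w')%MS.
    have <- : (- k^-1) *: (x *m rho t *m (1%:M - rho w')) = row i A *m rho v.
      rewrite mulmxBr mulmx1 -[x *m _ *m _]mulmxA -rhoM // xw xtE addrAC subrr sub0r.
      by rewrite scaleNr scalerN opprK scalerA mulVf ?scale1r.
    by rewrite scalemx_sub ?submxMl.
  have : (1%:M - rho (t * w')%g <= 1%:M - rho w')%MS.
    have -> : 1%:M - rho (t * w')%g = (1%:M - rho t) + rho t *m (1%:M - rho w').
      by rewrite mulmxBr mulmx1 rhoM // addrA subrK.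
    by rewrite addmx_sub ?submxMl // tE reflection_mx // (submx_trans (submxMl _ _)).
  move/mxrankS; rewrite -/(defect _) -/(defect _) leqNgt => /negP; apply.
  exact: leq_ltn_trans defr big_defect.
move=> y; rewrite inE => /predU1P[->//|]; apply: IHr => //; last first.
  by rewrite -{1}xt -mulmxA -rhoM.
rewrite -ltnS (leq_trans big_defect) // (leq_trans (defectM Wt Wr)) //.
by rewrite -add1n leq_add2r defect_reflection.
Qed.

(** Write t as s_i conjugated by w' with a_i w' negative. As t makes this root positive, some letter
    s_k of an S'-word for t changes its sign; the prefix before that letter conjugates t to s_k. *)
Lemma reflection_parabolic (S' : {set gT}) t : S' \subset S ->
  t \in T -> t \in <<S'>>%g -> t \in reflections <<S'>>%g S'.
Proof.
move=> S'S /reflectionsP[i [w [Ww tE]]].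
have [w' [Ww' {}tE neg]] : exists w', [/\ w' \in W, t = (s_ i ^ w')%g
    & (weyl_vector S K *m rho w'^-1%g) 0 i < 0].
  have WwV : w^-1%g \in W by rewrite groupV.
  have := weyl_vector_regular WS_coxeter A_cartan rho_rep i WwV.
  rewrite neq_lt => /orP[neg|pos]; first by exists w.
  (* Replacing w by s_i w negates the root and keeps t. *)
  exists (s_ i * w)%g; split; first by rewrite groupM.
    by rewrite tE conjgM [(s_ i ^ s_ i)%g]conjgE mulKg.
  rewrite invMg (simple_inv WS_coxeter) (act_simpleE WS_coxeter rho_rep) //.
  by rewrite (cartan_diag A_cartan); move: pos; lra.
case/gen_is_word=> r0 [r0S' r0t].
have [q qE] : exists q, r0 = map s_ q.
  by apply: simple_seq => y /r0S'; apply: subsetP.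
have tq : t = pr q by rewrite -r0t qE big_map.
have pos : 0 < (weyl_vector S K *m rho (w' * pr q)^-1%g) 0 i.
  have -> : (w' * pr q = s_ i * w')%g by rewrite -tq tE conjgE mulKVg.
  rewrite invMg (simple_inv WS_coxeter) (act_simpleE WS_coxeter rho_rep) ?groupV //.
  by rewrite (cartan_diag A_cartan); move: neg; lra.
have [a [k [b [qab e]]]] :=
  letter_sign_change WS_coxeter A_cartan rho_rep WS_irreducible Ww' neg pos.
have qS' j : j \in q -> s_ j \in S' by move=> qj; rewrite r0S' // qE map_f.
have W'a : pr a \in <<S'>>%g.
  rewrite big_seq group_prod // => j aj.
  by apply/mem_gen/qS'; rewrite qab mem_cat aj.
have Wa : (w' * pr a)%g \in W by rewrite groupM ?(prod_simple_in WS_coxeter).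
have conj_t : (t ^ pr a = s_ k)%g.
  rewrite tE -conjgM -[RHS]conjg1.
  apply/(reflection_rootP WS_coxeter A_cartan rho_rep WS_irreducible) => //.
  by right; rewrite e rho1 mulmx1.
apply/imset2P; exists (s_ k) (pr a)^-1%g; last by rewrite -conj_t conjgK.
  by rewrite qS' // qab mem_cat mem_head orbT.
by rewrite groupV.
Qed.

(** * Intervals below c and the count of covers *)

Section CoxeterElement.
Variable r : seq 'I_#|S|.
Hypotheses (r_uniq : uniq r) (r_full : forall i, i \in r).
Local Notation c := (pr r).
Local Notation trefl := (coxeter_refl r).
Local Notation before i := (take (index i r) r).
Local Notation after i := (drop (index i r).+1 r).

Let Wc : c \in W := prod_simple_in WS_coxeter r.
Let cW g : g \in <[c]>%g -> g \in W := @cycle_subW _ _ _ WS_coxeter r g.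

Lemma size_coxeter_word : size r = #|S|.
Proof.
rewrite -(card_uniqP r_uniq) -[RHS]card_ord; apply: eq_card => i.
by rewrite r_full.
Qed.

Lemma is_word_simple q : is_word T (map s_ q) (pr q).
Proof.
split; last by rewrite big_map.
by move=> _ /mapP[i _ ->]; apply: simple_reflection.
Qed.

Lemma defect_coxeter : defect c = #|S|.
Proof.
apply/eqP; rewrite -/(row_free _); apply: inj_row_free => x.
rewrite mulmxBr mulmx1 => /eqP; rewrite subr_eq0 eq_sym => /eqP.
by apply: (coxeter_fix0 WS_coxeter A_cartan rho_rep WS_irreducible).
Qed.

Lemma length_coxeter : l c = #|S|.
Proof.
apply/eqP; rewrite eqn_leq; apply/andP; split.
  by have := word_length_min (is_word_simple r); rewrite size_map size_coxeter_word.
have [|w wc <-] := @word_lengthP _ T c; first by rewrite genT.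
by rewrite -[X in (X <= _)%N]defect_coxeter defect_word.
Qed.

Lemma size_coxeter_omit i : (size (before i ++ after i)).+1 = #|S|.
Proof.
by rewrite -[RHS]size_coxeter_word [in RHS](split_word r_full i) !size_cat /= addnS.
Qed.

Lemma coxeter_omit_word i : is_word T (map s_ (before i ++ after i)) (coxeter_omit r i).
Proof. by have := is_word_simple (before i ++ after i); rewrite big_cat. Qed.

Lemma defect_coxeter_omit i : (#|S| <= (defect (coxeter_omit r i)).+1)%N.
Proof.
have Tt := coxeter_refl_in WS_coxeter r i; have Wt := reflW Tt.
have Wo : coxeter_omit r i \in W.
  by rewrite groupM ?(prod_simple_in WS_coxeter).
rewrite -[X in (X <= _)%N]defect_coxeter -(mulgK (trefl i) c).
rewrite (coxeter_omitE WS_coxeter r_full).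
rewrite (leq_trans (defectM _ _)) ?groupV // -[X in (_ <= X)%N]addn1 leq_add2l.
by apply: defect_reflection; rewrite -[(trefl i)^-1%g]mulg1
  -(reflections_sqr WS_coxeter Tt) mulKg.
Qed.

Lemma length_coxeter_omit i : (l (coxeter_omit r i)).+1 = #|S|.
Proof.
apply/eqP; rewrite eqn_leq; apply/andP; split.
  have := word_length_min (coxeter_omit_word i); rewrite size_map => len.
  by rewrite -[X in (_ <= X)%N](size_coxeter_omit i) ltnS.
have [|w ww <-] := @word_lengthP _ T (coxeter_omit r i).
  exact: is_word_gen (coxeter_omit_word i).
by rewrite (leq_trans (defect_coxeter_omit i)) // ltnS defect_word.
Qed.

(** The reflection t^c is t_i conjugated by a power g of c, which commutes with c; so t c = c t^c is
    conjugate to c t_i, of length one less than c. *)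
Lemma length_coxeter_reflection t : t \in T -> (l (t * c)%g).+1 = l c.
Proof.
move=> Tt; have Ttc : (t ^ c)%g \in T by rewrite (reflectionsJ _ _ Wc).
have : (0 < #|[set p : gT * 'I_#|S| |
    (p.1 \in <[c]>%g) && (trefl p.2 ^ p.1 == t ^ c)%g]|)%N.
  by rewrite (card_coxeter_refl WS_coxeter A_cartan rho_rep WS_irreducible).
case/card_gt0P=> -[g i]; rewrite inE /= => /andP[cg /eqP tE].
have -> : (t * c = coxeter_omit r i ^ g)%g.
  rewrite -(coxeter_omitE WS_coxeter r_full) conjMg tE.
  have -> : (c ^ g = c)%g by case/cycleP: cg => k ->; rewrite conjgE -expgS expgSr mulKg.
  by rewrite conjgE mulgA mulgV mul1g.
rewrite word_lengthJ ?length_coxeter_omit ?length_coxeter //.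
  by rewrite (subsetP (reflections_norm W S)) // cW.
exact: is_word_gen (coxeter_omit_word i).
Qed.

Lemma coxeter_omit_element i : coxeter_element (S :\ s_ i) (coxeter_omit r i).
Proof.
exists (map s_ (before i ++ after i)); last by rewrite (coxeter_omit_word i).2.
have u : uniq (i :: before i ++ after i).
  by move: r_uniq; rewrite {1}(split_word r_full i) -cat_rcons -cats1 -catA uniq_catCA.
apply: uniq_perm; rewrite ?enum_uniq // ?map_inj_uniq; first by case/andP: u.
  exact: enum_val_inj.
move=> s; rewrite mem_enum in_setD1; apply/mapP/andP=> [[j jr ->]|[ns]].
  rewrite simple_mem; split=> //; apply: contraTneq u => /enum_val_inj ji.
  by rewrite /= -{1}ji jr.
case/simple_onto=> j sE; exists j => //.
have := r_full j; rewrite {1}(split_word r_full i) !mem_cat inE.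
by case: eqVneq => // ji; rewrite sE ji eqxx in ns.
Qed.

Lemma NC_parabolic i cs : coxeter_element (S :\ s_ i) cs ->
  NC (parabolic S (s_ i)) (S :\ s_ i) cs = #|absolute_interval T 1%g (c * trefl i)%g|.
Proof.
set S' := S :\ s_ i => cs_cox; rewrite /NC /noncrossing /=.
have S'S : S' \subset S by apply: subsetDl.
set T' := reflections _ S'.
have W'W : <<S'>>%g \subset W by rewrite -(coxeter_gen WS_coxeter) genS.
have T'T : T' \subset T.
  apply/subsetP=> _ /imset2P[s w S's W'w ->]; apply/imset2P.
  by exists s w; rewrite ?(subsetP S'S) ?(subsetP W'W).
have S'T' : S' \subset T'.
  by apply/subsetP=> s S's; apply/imset2P; exists s 1%g; rewrite ?group1 ?conjg1.
have T'W' : <<T'>>%g = <<S'>>%g.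
  apply/eqP; rewrite eqEsubset (genS S'T') andbT gen_subG; apply/subsetP=> t.
  by case/imset2P=> s w S's W'w ->; rewrite groupJ // mem_gen.
have W'norm : <<S'>>%g \subset 'N(T')%g.
  apply/subsetP=> w W'w; rewrite inE; apply/subsetP=> t; rewrite mem_conjg.
  case/imset2P=> s v S's W'v e; apply/imset2P; exists s (v * w)%g => //.
    by rewrite groupM.
  by rewrite conjgM -e conjgKV.
have omit_in : coxeter_omit r i \in <<S'>>%g.
  have [q qS' ->] := coxeter_omit_element i; rewrite big_seq group_prod // => s.
  by rewrite (perm_mem qS') mem_enum => S's; rewrite mem_gen.
have [g W'g ->] := coxeter_element_conj WS_coxeter A_cartan rho_rep WS_irreducible
  S'S (coxeter_omit_element i) cs_cox.
rewrite card_absolute_intervalJ ?T'W' ?(subsetP W'norm) //.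
rewrite (coxeter_omitE WS_coxeter r_full) (absolute_interval_sub T'T) ?T'W' //.
move=> q q_word szq t qt.
have fix_omega : omega i *m rho (coxeter_omit r i) = omega i.
  rewrite rhoM ?(prod_simple_in WS_coxeter) // mulmxA.
  rewrite (omega_word WS_coxeter rho_rep); last exact: notin_before.
  by rewrite (omega_word WS_coxeter rho_rep); last exact: notin_after.
(* A reduced word for c t_i has one letter fewer than S has elements, hence no more letters than the
   defect, so each letter fixes every vector that c t_i fixes. *)
have omega_t : omega i *m rho t = omega i.
  apply: (minimal_word_fix q_word) qt => //.
  by rewrite szq -ltnS length_coxeter_omit defect_coxeter_omit.
have Tt : t \in T by apply: q_word.1.
apply: (reflection_parabolic S'S Tt).
have dom : dominant (omega i) by apply: omega_dominant.
(* The stabilizer of omega_i is generated by the simple reflections other than s_i. *)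
have [_] := dominant_stabilizer WS_coxeter A_cartan rho_rep (reflW Tt) dom dom omega_t.
apply: subsetP; apply: genS; apply/subsetP=> y /imsetP[k].
rewrite inE omegaE => ki ->; rewrite in_setD1 simple_mem andbT.
by apply: contraTneq ki => /enum_val_inj ->; rewrite eqxx oner_eq0.
Qed.

(** Doubled so as to stay among natural numbers, since h may be odd. *)
Lemma double_covers (cs : gT -> gT) :
  (forall s, s \in S -> coxeter_element (S :\ s) (cs s)) ->
  (2 * E W S c = #[c]%g * \sum_(s in S) NC (parabolic S s) (S :\ s) (cs s))%N.
Proof.
move=> cs_cox; pose F t := #|absolute_interval T 1%g (c * t)%g|.
have genc : c \in <<T>>%g by rewrite genT.
have normT : <<T>>%g \subset 'N(T)%g by rewrite genT reflections_norm.
have Nc : c \in 'N(T)%g by rewrite (subsetP normT).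
(* Conjugation by c turns c t into c t^c, which is also t c: F is invariant, and F t counts the
   interval below t c as well. *)
have Fc t : t \in T -> F (t ^ c)%g = F t.
  move=> Tt; rewrite /F -(card_absolute_intervalJ Nc (v := (c * t)%g)).
    by rewrite conjMg [(c ^ c)%g]conjgE mulKg.
  by rewrite genT groupM // reflW.
have -> : E W S c = (\sum_(t in T) F t)%N.
  rewrite [LHS](card_absolute_covers (reflections_sqr WS_coxeter) normT genc
    length_coxeter_reflection).
  apply: eq_bigr => t Tt; rewrite -(Fc t Tt) /F.
  by rewrite conjgE mulgA mulgV mul1g.
rewrite (sum_reflections WS_coxeter A_cartan rho_rep WS_irreducible r_uniq r_full Fc).
congr (_ * _)%N; rewrite [RHS]big_enum_val /=.
apply: eq_bigr => i _; exact: esym (NC_parabolic (cs_cox _ (simple_mem i))).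
Qed.

End CoxeterElement.

End ReflectionLength.

Theorem corollary3p9 (gT : finGroupType) (W : {group gT}) (S : {set gT})
    (h : nat) (c : gT) (cs : gT -> gT)
    (WS_coxeter : coxeter_system W S)
    (WS_irreducible : coxeter_irreducible S)
    (h_number : coxeter_number S h)
    (c_coxeter : coxeter_element S c)
    (cs_coxeter : forall s, s \in S -> coxeter_element (S :\ s) (cs s)) :
  (E W S c)%:R =
    h%:R / 2 * \sum_(s in S) (NC (parabolic S s) (S :\ s) (cs s))%:R :> rat.
Proof.
have [A [rho [A_cartan rho_rep]]] :=
  exists_geometric_rep Rdefinitions.R WS_coxeter.
have [c0 c0_coxeter ->] := h_number.
(* The number h is the order of a Coxeter element c0 that may differ from c; conjugacy makes the
   orders equal. *)
have [g _ ->] := coxeter_element_conj WS_coxeter A_cartan rho_rep WS_irreducible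
  (subxx S) c_coxeter c0_coxeter.
rewrite orderJ; have [r [r_uniq rS ->]] := coxeter_element_word (subxx S) c_coxeter.
have r_full i : i \in r by rewrite rS simple_mem.
have := double_covers WS_coxeter A_cartan rho_rep WS_irreducible r_uniq r_full cs_coxeter.
move/(congr1 (fun n => n%:R : rat)); rewrite !natrM natr_sum => e.
by rewrite mulrAC -e mulrAC mulfV ?mul1r.
Qed.
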